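(* Suppose that $X_1, X_2, \dots$ is a sequence of independent random variables, defined on a probability space $(\Omega,\mathcal A,\mathsf P)$, with distribution $P \in \mathcal P(\mathbb S^{d-1})$, and let $P_n(\omega) \in \mathcal P(\mathbb S^{d-1})$ be the (random) empirical measure corresponding to $X_1(\omega),\dots,X_n(\omega)$. (i) Then $$\mathsf P\left(\left\{\omega \in \Omega : \lim_{n\to\infty} \sup_{x \in \mathbb S^{d-1}} \left|\mathrm{ahD}(x;P_n(\omega)) - \mathrm{ahD}(x;P)\right| = 0\right\}\right) = 1.$$ (ii) If $P$ is such that $\mathrm{ahD}$ is strictly monotone for $P$, then for any closed interval $A \subset \left(\min_{x \in \mathbb S^{d-1}} \mathrm{ahD}(x;P), \max_{x \in \mathbb S^{d-1}} \mathrm{ahD}(x;P)\right)$, $$\mathsf P\left(\left\{\omega \in \Omega : \lim_{n\to\infty} \sup_{\alpha \in A} \delta_H\left(\mathrm{ahD}_\alpha(P_n(\omega)), \mathrm{ahD}_\alpha(P)\right) = 0\right\}\right) = 1.$$ (iii) If $P$ satisfies $P(\partial H) = 0$ for all $H \in \mathcal H_0$ and $\mathfrak M(P)$ is a singleton, then $$\mathsf P\left(\left\{\omega \in \Omega : \lim_{n\to\infty} \delta_H\left(\mathfrak M(P_n(\omega)), \mathfrak M(P)\right) = 0\right\}\right) = 1.$$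
   Context: Let $d \ge 2$ be an integer, $\mathbb S^{d-1} = \{x \in \mathbb R^d : \|x\| = 1\}$, and let $\mathcal P(\mathbb S^{d-1})$ be the set of Borel probability measures on $\mathbb S^{d-1}$. The empirical measure $P_n(\omega)$ assigns mass $1/n$ to each of $X_1(\omega),\dots,X_n(\omega)$. For a Borel set $A \subseteq \mathbb R^d$ and $P \in \mathcal P(\mathbb S^{d-1})$, write $P(A) = P(A \cap \mathbb S^{d-1})$. For $u \in \mathbb S^{d-1}$ let $H_{0,u} = \{y \in \mathbb R^d : \langle y,u\rangle \ge 0\}$ and $\mathcal H_0 = \{H_{0,u} : u \in \mathbb S^{d-1}\}$; $\partial H$ is the topological boundary of $H$. The angular halfspace depth is $$\mathrm{ahD}(x;P) = \inf\{P(H_{0,u}) : u \in \mathbb S^{d-1},\ x \in H_{0,u}\},\qquad x \in \mathbb S^{d-1}.$$ Its central regions are the closed sets $\mathrm{ahD}_\alpha(P) = \{x \in \mathbb S^{d-1} : \mathrm{ahD}(x;P) \ge \alpha\}$, and the set of medians is the non-empty compact set $\mathfrak M(P) = \{x \in \mathbb S^{d-1} : \mathrm{ahD}(x;P) = \max_{y \in \mathbb S^{d-1}} \mathrm{ahD}(y;P)\}$. The depth $\mathrm{ahD}$ is strictly monotone for $P$ if for each $\alpha \in \left(\min_{x \in \mathbb S^{d-1}} \mathrm{ahD}(x;P), \max_{x \in \mathbb S^{d-1}} \mathrm{ahD}(x;P)\right)$ we have $\mathrm{ahD}_\alpha(P) = \mathrm{cl}\left(\{x \in \mathbb S^{d-1}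 : \mathrm{ahD}(x;P) > \alpha\}\right)$, where $\mathrm{cl}$ denotes closure. The Hausdorff distance of compact sets $K,L \subset \mathbb R^d$ is $\delta_H(K,L) = \max\{\sup_{x \in K}\inf_{y \in L}\|x-y\|, \sup_{x \in L}\inf_{y\in K}\|x-y\|\}$. *)

(* Defs.v *)
(* MathComp / MathComp-Analysis *)
From HB Require Import structures.
From mathcomp Require Import all_boot all_order all_algebra.
From mathcomp Require Import all_classical all_reals all_analysis.

Set Implicit Arguments.
Unset Strict Implicit.
Unset Printing Implicit Defensive.

Import Order.TTheory GRing.Theory Num.Theory.
Import numFieldNormedType.Exports.

Local Open Scope classical_set_scope.
Local Open Scope ring_scope.

(* 'rV[R]_d with its Borel sigma-algebra.  The library's topology on 'rV[R]_d
   is the product topology, i.e. the usual topology of R^d; its norm is the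
   sup norm, so the Euclidean one is defined below. *)
Definition borelRd (R : realType) (d : nat) : measurableType _ :=
  g_sigma_algebraType (@open 'rV[R]_d).

Section Geometry.
Context {R : realType} {d : nat}.
Implicit Types (x y u : 'rV[R]_d) (A K L : set 'rV[R]_d).

Definition dot x y : R := \sum_(i < d) x ord0 i * y ord0 i.

Definition enorm x : R := Num.sqrt (dot x x).

Definition sphere : set 'rV[R]_d := [set x | enorm x = 1].

Definition halfspace0 u : set 'rV[R]_d := [set y | 0 <= dot y u].

Definition halfspaces0 : set (set 'rV[R]_d) := [set halfspace0 u | u in sphere].

Definition boundary A : set 'rV[R]_d := closure A `\` A°.

(* Extended-real valued, so that an empty K is at distance +oo from a nonempty
   L (empirical central regions can be empty for finitely many n). *)
Definition hausdorff_dist K L : \bar R :=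
  maxe (ereal_sup [set ereal_inf [set (enorm (x - y))%:E | y in L] | x in K])
       (ereal_sup [set ereal_inf [set (enorm (x - y))%:E | y in K] | x in L]).

End Geometry.

Section AngularDepth.
Context {R : realType} {d : nat}.

(* A Borel probability measure on the sphere is represented by a Borel measure
   on R^d giving mass 1 to the sphere. *)
Implicit Type P : {measure set (borelRd R d) -> \bar R}.

Definition ahD P (x : 'rV[R]_d) : R :=
  inf [set fine (P (halfspace0 u)) |
       u in [set u | sphere u /\ halfspace0 u x]].

(* Both extrema over the sphere are attained when P is a probability measure
   on the sphere: ahD is upper semicontinuous, and a limit point of directions
   minimizing u |-> P (halfspace0 u) is a minimizer of the depth. *)
Definition ahD_min P : R := inf [set ahD P x | x in sphere].
Definition ahD_max P : R := sup [set ahD P x | x in sphere].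

Definition ahD_region P (alpha : R) : set 'rV[R]_d :=
  [set x | sphere x /\ alpha <= ahD P x].

Definition medians P : set 'rV[R]_d :=
  [set x | sphere x /\ ahD P x = ahD_max P].

Definition strictly_monotone P : Prop :=
  forall alpha : R, ahD_min P < alpha < ahD_max P ->
    ahD_region P alpha = closure [set x | sphere x /\ alpha < ahD P x].

(* Mass 1/n at each of x_0, ..., x_(n-1); meaningful for 0 < n. *)
Definition empirical (n : nat) (x : nat -> borelRd R d) :
    {measure set (borelRd R d) -> \bar R} :=
  mscale (n%:R^-1)%:nng (msum (fun i => \d_(x i)) n).

End AngularDepth.

Section Probability.
Context {R : realType} {disp disp' : measure_display}
  {Omega : measurableType disp} {T : measurableType disp'}.
Variable Pr : probability Omega R.

Definition mutually_independent (X : nat -> {RV Pr >-> T}) : Prop :=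
  forall (s : seq nat) (B : nat -> set T), uniq s ->
    (forall i, measurable (B i)) ->
    Pr (\bigcap_(i in [set` s]) (X i @^-1` B i)) =
      (\prod_(i <- s) Pr (X i @^-1` B i))%E.

(* Measurability is part of the claim: the value of Pr is only meaningful on
   measurable sets. *)
Definition has_probability_one (E : set Omega) : Prop :=
  measurable E /\ Pr E = 1%E.

End Probability.

(* Main.v *)
Require Import Defs.
From mathcomp Require Import all_boot all_order all_algebra.
From mathcomp Require Import all_classical all_reals all_analysis.
From mathcomp Require Import measurable_realfun.
From mathcomp Require Import ring lra zify.

Set Implicit Arguments.
Unset Strict Implicit.
Unset Printing Implicit Defensive.

Import Order.TTheory GRing.Theory Num.Theory.
Import numFieldNormedType.Exports.

Local Open Scope classical_set_scope.
Local Open Scope ring_scope.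

(** Everything reduces to one deterministic statement: almost surely, the
    empirical masses of all halfspaces through the origin converge uniformly
    to their masses under P.

    Uniformity comes from finite bracketing (finite_bracketing): for every
    e > 0 the family of these halfspaces is covered by finitely many brackets
    of Borel sets L included in U with P (U minus L) < e, so the strong law for
    the finitely many sets L and U is enough.  P may charge hyperplanes, so a
    bracket cannot be chosen by moving the normal vector only.  Near a
    direction u1, the points with |<y,u1>| > del are on the right side for
    every nearby u, the points with 0 < |<y,u1>| <= del have small mass, and
    on the hyperplane orthogonal to u1 the halfspaces are again halfspaces
    through the origin of a space of smaller dimension: the brackets are built
    by induction on the dimension, with compactness of the sphere at each
    step.  The strong law for one Borel set (event_lln) comes from
    pairwise independence: the variance bound makes the squared deviations
    summable in mean along n = k^2, and the counts change too slowly to deviate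
    between consecutive squares.

    Since the depth is an infimum of halfspace masses, the deviation of the
    depths is at most that of the masses, which gives the first claim.  The
    other two are deterministic consequences.  The depth for P is upper
    semicontinuous (ahD_usc), and compactness of the sphere times [a, b]
    turns strict monotonicity into a uniform statement: every point of depth
    at least alpha - e is within t of a point of depth at least alpha + e
    (strictly_monotone_uniform).  A depth within e of that of P then has
    regions within t of those of P (region_stability).  If the median m is
    unique, the same compactness argument shows that near-maximal depth forces
    a point to be close to m (median_stability).

    The events also have to be measurable, although they involve suprema over
    uncountable sets of points and levels.  The condition ahD Q x < c only
    involves countably many halfspaces: it says that some rational vector v
    with <x,v> > 0 has Q-mass below c (ahD_ltP).  Hence the set of x with
    c <= ahD Q x is a random closed set cut out by countably many constraints,
    and whether it meets a given compact, then a given open, subset of the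
    sphere is an event by the finite intersection property
    (measurable_compact_hit, measurable_open_hit).  All the suprema are
    expressed through such hitting events, using that empirical depths are
    multiples of 1/n. *)

(** * Euclidean geometry of the sphere *)

Section Euclid.
Context {R : realType} {d : nat}.
Implicit Types (x y z u v : 'rV[R]_d) (A K L : set 'rV[R]_d).

Lemma dotC x y : dot x y = dot y x.
Proof. by apply: eq_bigr => i _; rewrite mulrC. Qed.

Lemma dotDl x y z : dot (x + y) z = dot x z + dot y z.
Proof. by rewrite -big_split; apply: eq_bigr => i _; rewrite mxE mulrDl. Qed.

Lemma dotZl a x y : dot (a *: x) y = a * dot x y.
Proof. by rewrite mulr_sumr; apply: eq_bigr => i _; rewrite mxE mulrA. Qed.

Lemma dotNl x y : dot (- x) y = - dot x y.
Proof. by rewrite -scaleN1r dotZl mulN1r. Qed.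

Lemma dotBl x y z : dot (x - y) z = dot x z - dot y z.
Proof. by rewrite dotDl dotNl. Qed.

Lemma dotDr x y z : dot x (y + z) = dot x y + dot x z.
Proof. by rewrite !(dotC x) dotDl. Qed.

Lemma dotZr a x y : dot x (a *: y) = a * dot x y.
Proof. by rewrite !(dotC x) dotZl. Qed.

Lemma dotBr x y z : dot x (y - z) = dot x y - dot x z.
Proof. by rewrite !(dotC x) dotBl. Qed.

Lemma dot0l x : dot 0 x = 0.
Proof. by rewrite -(scale0r 0) dotZl mul0r. Qed.

Lemma dot0r x : dot x 0 = 0.
Proof. by rewrite dotC dot0l. Qed.

Lemma dotxx_ge0 x : 0 <= dot x x.
Proof. by apply: sumr_ge0 => i _; rewrite -expr2 sqr_ge0. Qed.

Lemma enorm_ge0 x : 0 <= enorm x. Proof. exact: sqrtr_ge0. Qed.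

Lemma enorm2 x : enorm x ^+ 2 = dot x x.
Proof. by rewrite sqr_sqrtr// dotxx_ge0. Qed.

Lemma dotxx_eq0 x : dot x x = 0 -> x = 0.
Proof.
move=> x0; apply/rowP => i; rewrite mxE; apply/eqP.
move/eqP: x0; rewrite psumr_eq0; last by move=> j _; rewrite -expr2 sqr_ge0.
by move=> /allP /(_ i (mem_index_enum _))/=; rewrite mulf_eq0 orbb.
Qed.

Lemma enorm_eq0 x : enorm x = 0 -> x = 0.
Proof. by move=> x0; apply: dotxx_eq0; rewrite -enorm2 x0 expr0n. Qed.

Lemma enorm0 : enorm (0 : 'rV[R]_d) = 0.
Proof. by rewrite /enorm dot0l sqrtr0. Qed.

Lemma enormZ a x : enorm (a *: x) = `|a| * enorm x.
Proof.
by rewrite /enorm dotZl dotZr mulrA -expr2 sqrtrM ?sqr_ge0// sqrtr_sqr.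
Qed.

Lemma enormN x : enorm (- x) = enorm x.
Proof. by rewrite -scaleN1r enormZ normrN1 mul1r. Qed.

Lemma enorm_sub_sym x y : enorm (x - y) = enorm (y - x).
Proof. by rewrite -enormN opprB. Qed.

Lemma sphereE x : sphere x <-> dot x x = 1.
Proof.
rewrite /sphere /=; split=> [h|h]; first by rewrite -enorm2 h expr1n.
by rewrite /enorm h sqrtr1.
Qed.

Lemma cauchy_schwarz x y : `|dot x y| <= enorm x * enorm y.
Proof.
have [->|x0] := eqVneq x 0; first by rewrite dot0l normr0 enorm0 mul0r.
have nx0 : 0 < dot x x.
  rewrite lt_neqAle dotxx_ge0 andbT eq_sym.
  by apply: contra x0 => /eqP/dotxx_eq0/eqP.
rewrite -(@ler_pXn2r _ 2)// ?nnegrE ?mulr_ge0 ?enorm_ge0//.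
rewrite exprMn !enorm2 real_normK ?num_real//.
have := dotxx_ge0 (dot x x *: y - dot x y *: x).
rewrite !dotBl !dotBr !dotZl !dotZr (dotC y x) => h.
have {}h : 0 <= dot x x * (dot x x * dot y y - dot x y ^+ 2) by nra.
by rewrite -subr_ge0 -(pmulr_rge0 _ nx0).
Qed.

Lemma enormD x y : enorm (x + y) <= enorm x + enorm y.
Proof.
rewrite -(@ler_pXn2r _ 2)// ?nnegrE ?addr_ge0 ?enorm_ge0//.
rewrite sqrrD !enorm2 dotDl !dotDr (dotC y x).
have := le_trans (ler_norm _) (cauchy_schwarz x y).
by rewrite mulr2n; lra.
Qed.

Lemma enorm_triangle y x z : enorm (x - z) <= enorm (x - y) + enorm (y - z).
Proof.
have -> : x - z = (x - y) + (y - z) by rewrite addrA subrK.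
exact: enormD.
Qed.

Lemma dot_sphere_le x y : sphere x -> `|dot x y| <= enorm y.
Proof. by move=> hx; have := cauchy_schwarz x y; rewrite hx mul1r. Qed.

Lemma normalize_sphere x : x != 0 -> sphere ((enorm x)^-1 *: x).
Proof.
move=> x0; rewrite /sphere/= enormZ ger0_norm ?invr_ge0 ?enorm_ge0// mulVf//.
by apply: contra x0 => /eqP/enorm_eq0/eqP.
Qed.

Lemma enorm_gt0 x : x != 0 -> 0 < enorm x.
Proof.
move=> x0; rewrite lt_neqAle enorm_ge0 andbT eq_sym.
by apply: contra x0 => /eqP/enorm_eq0/eqP.
Qed.

Lemma halfspace0Z a u : 0 < a -> halfspace0 (a *: u) = halfspace0 u.
Proof.
by move=> a0; apply/seteqP; split=> y; rewrite /halfspace0/= dotZr pmulr_rge0.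
Qed.

Lemma mx_norm_le_enorm x : `|x| <= enorm x.
Proof.
rewrite [leLHS]/Num.norm/= mx_normrE; apply/bigmax_leP; split=> [|[i j] _]; first exact: enorm_ge0.
rewrite /= -(@ler_pXn2r _ 2)// ?nnegrE ?enorm_ge0// enorm2 real_normK ?num_real//.
rewrite ord1 /dot (bigD1 j)//= -expr2 lerDl.
by apply: sumr_ge0 => k _; rewrite -expr2 sqr_ge0.
Qed.

Lemma continuous_dot u : continuous (fun x => dot x u).
Proof.
apply: continuous_big; first exact: add_continuous.
move=> i _ x; have xi := @coord_continuous R _ _ ord0 i x.
exact: (cvgM xi (cvg_cst (u ord0 i))).
Qed.

Lemma continuous_enormB y : continuous (fun x => enorm (x - y)).
Proof.
suff h : continuous (fun x => dot (x - y) (x - y)).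
  by move=> x; exact: continuous_comp (h x) (@sqrt_continuous R _).
apply: continuous_big; first exact: add_continuous.
move=> i _ x; have xi := @coord_continuous R _ _ ord0 i x.
have {}xi := cvgB xi (cvg_cst (y ord0 i)).
have {}xi := cvgM (xi _ _) (xi _ _).
have e : (fun z : 'rV[R]_d => (z - y) ord0 i * (z - y) ord0 i) =
         (fun z => (z ord0 i - y ord0 i) * (z ord0 i - y ord0 i)).
  by apply/funext => z; rewrite !mxE.
by rewrite e; exact: xi.
Qed.

Lemma nbhs_enormP x A :
  nbhs x A <-> exists2 e : R, 0 < e & forall y, enorm (x - y) < e -> A y.
Proof.
split=> [/nbhs_ballP[e/= e0 xA]|[e e0 xA]].
  exists e => // y xy; apply: xA; rewrite -ball_normE/=.
  exact: le_lt_trans (mx_norm_le_enorm _) xy.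
apply: (@filterS _ _ _ [set y | enorm (y - x) < e]).
  by move=> y /= yx; apply: xA; rewrite enorm_sub_sym.
have h := @continuous_enormB x x; rewrite /continuous_at subrr enorm0 in h.
by have /h : nbhs (0 : R) [set r | r < e] by exact: lt_nbhsl.
Qed.

Lemma open_enormP A :
  open A <-> forall x, A x -> exists2 e : R, 0 < e & forall y, enorm (x - y) < e -> A y.
Proof.
rewrite openE; split=> h x Ax; first by apply/nbhs_enormP; exact: h.
by apply/nbhs_enormP; exact: h.
Qed.

Lemma closed_halfspace0 u : closed (halfspace0 u).
Proof.
have -> : halfspace0 u = (fun x => dot x u) @^-1` [set r | 0 <= r] by [].
by apply: closed_comp; [move=> x _; exact: continuous_dot|exact: closed_ge].
Qed.

Lemma closed_sphere : closed (sphere : set 'rV[R]_d).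
Proof.
have -> : sphere = (fun x : 'rV[R]_d => enorm (x - 0)) @^-1` [set 1].
  by apply/seteqP; split=> x; rewrite /sphere/= subr0.
apply: closed_comp; last exact: closed_eq.
by move=> x _; exact: continuous_enormB.
Qed.

Lemma compact_sphere : compact (sphere : set 'rV[R]_d).
Proof.
apply: bounded_closed_compact; last exact: closed_sphere.
exists 1; split=> // r r1 x /= xS.
by apply: (le_trans (mx_norm_le_enorm x)); rewrite xS ltW.
Qed.

Definition ratv (q : 'rV[rat]_d) : 'rV[R]_d := map_mx ratr q.

Lemma dense_ratv x (e : R) : 0 < e -> exists q, enorm (x - ratv q) < e.
Proof.
move=> e0.
have : nbhs x [set y | enorm (x - y) < e] by apply/nbhs_enormP; exists e.
move=> /nbhs_ballP[f /= f0 xf].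
have h (i : 'I_d) : exists q : rat, `|x ord0 i - ratr q| < f.
  have [|q] := @rat_in_itvoo R (x ord0 i - f) (x ord0 i + f); first by lra.
  by rewrite in_itv/= => hq; exists q; rewrite distrC ltr_distl.
exists (\row_i xget 0 [set q | `|x ord0 i - ratr q| < f]).
apply: xf; rewrite -ball_normE/= [ltLHS]/Num.norm/= mx_normrE; apply/bigmax_ltP; split=> // -[i j] _.
rewrite !mxE ord1 /=; have [q qP] := h j.
by apply: (@xgetPex _ 0 [set q | `|x ord0 j - ratr q| < f]); exists q.
Qed.

End Euclid.

(** * Finite bracketing of central halfspaces *)

(** Compactness in the form needed for bracketing: local finite families
    glue to a global one.  The filter of finite families ordered by inclusion
    makes this an instance of near-covering, with no choice of neighborhoods. *)
Lemma compact_finite_selection (T : topologicalType) (X : Type) (A : set T)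
    (Q : T -> X -> Prop) : compact A ->
  (forall x, A x -> exists2 F : set X, finite_set F &
     \forall y \near x, A y -> exists2 z, F z & Q y z) ->
  exists2 F : set X, finite_set F & forall y, A y -> exists2 z, F z & Q y z.
Proof.
move=> /compact_near_coveringP cA h.
pose G := filter_from (@finite_set X) (fun F0 => [set F | F0 `<=` F]).
have FG : Filter G.
  apply: filter_from_filter; first by exists set0; exact: finite_set0.
  move=> F F' fF fF'; exists (F `|` F'); first by rewrite finite_setU.
  by move=> H FF'H; split=> z Fz; apply: FF'H; [left|right].
have /cA : forall x, A x -> \forall y \near x & F \near G,
    A y -> exists2 z, F z & Q y z.
  move=> x Ax; have [F fF xF] := h x Ax.
  exists ([set y | A y -> exists2 z, F z & Q y z], [set F' | F `<=` F']).
    by split=> //; exists F.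
  move=> [y F'] /= [yF FF'] Ay; have [z Fz Qz] := yF Ay.
  by exists z => //; exact: FF'.
move=> [F fF FP]; exists F => // y Ay.
exact: (FP F (@subset_refl _ _) y Ay Ay).
Qed.

Section Borel.
Context {R : realType} {d : nat}.
Local Notation E := (borelRd R d).
Implicit Types (x y u : 'rV[R]_d) (A : set 'rV[R]_d).

Lemma open_measurableRd A : open A -> measurable (A : set E).
Proof. by move=> oA; apply: sub_sigma_algebra. Qed.

Lemma closed_measurableRd A : closed A -> measurable (A : set E).
Proof.
move=> cA; rewrite -(setCK A); apply: measurableC; apply: open_measurableRd.
exact: closed_openC.
Qed.

Lemma measurable_sphere : measurable (sphere : set E).
Proof. by apply: closed_measurableRd; exact: closed_sphere. Qed.

Lemma measurable_halfspace0 u : measurable (halfspace0 u : set E).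
Proof. by apply: closed_measurableRd; exact: closed_halfspace0. Qed.

Lemma measurable_dot u (B : set R) : open B \/ closed B ->
  measurable ([set y | B (dot y u)] : set E).
Proof.
move=> [oB|cB].
  apply: open_measurableRd.
  by apply: (@open_comp _ _ (fun y => dot y u) B) => // x _; exact: continuous_dot.
apply: closed_measurableRd.
by apply: (@closed_comp _ _ (fun y => dot y u) B) => // x _; exact: continuous_dot.
Qed.

End Borel.

Lemma measure_lt_bigcap (dsp : measure_display) (T : measurableType dsp)
    (R : realType) (P : {measure set T -> \bar R}) (F : (set T)^nat) (c : \bar R) :
  (P setT < +oo)%E -> (forall n, measurable (F n)) ->
  {homo F : n m / (n <= m)%N >-> (m <= n)%O} ->
  (P (\bigcap_n F n) < c)%E -> exists n, (P (F n) < c)%E.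
Proof.
move=> Pfin mF dF Pc.
have P0 : (P (F 0%N) < +oo)%E.
  by apply: le_lt_trans Pfin; rewrite le_measure ?inE.
have mI : measurable (\bigcap_n F n) by exact: bigcapT_measurable.
have := nonincreasing_cvg_mu P0 mF mI dF.
move=> /(_ [set r | (r < c)%E])[]; first exact: open_ereal_lt'.
by move=> n _ /(_ n (leqnn n)) ?; exists n.
Qed.

Section Bracketing.
Context {R : realType} {d : nat}.
Local Notation E := (borelRd R d).
Variable P : {measure set E -> \bar R}.
Hypothesis Pfin : (P setT < +oo)%E.
Implicit Types (x y u : 'rV[R]_d) (A : set 'rV[R]_d).

Definition bracket (e : R) (A : set E) (LU : set E * set E) : Prop :=
  [/\ measurable LU.1, measurable LU.2, LU.1 `<=` A, A `<=` LU.2 &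
      (P (LU.2 `\` LU.1) < e%:E)%E].

Definition slab u (del : R) : set E :=
  [set y | sphere y /\ 0 < `|dot y u| <= del].

Lemma measurable_slab u del : measurable (slab u del).
Proof.
have -> : slab u del =
    sphere `&` ([set y | [set r | r != 0] (dot y u)] `&`
                [set y | [set` `[- del, del]] (dot y u)]).
  apply/seteqP; split=> y; rewrite /slab/= normr_gt0 ler_norml.
    by case=> ? /andP[? ?]; split=> //; split=> //=; rewrite in_itv.
  by case=> ? [/= ?]; rewrite in_itv/= => ?; split=> //; apply/andP.
apply: measurableI; first exact: measurable_sphere.
apply: measurableI.
  by apply: (@measurable_dot _ _ u [set r | r != 0]); left; exact: open_neq.
by apply: (@measurable_dot _ _ u [set` `[- del, del]]); right; exact: itv_closed.
Qed.

(** The closed slabs without their central hyperplane decrease to the empty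
    set; the hyperplane itself may carry mass and is treated by induction. *)
Lemma thin_slab u (e : R) : 0 < e -> exists2 del : R, 0 < del & (P (slab u del) < e%:E)%E.
Proof.
move=> e0.
pose F n := slab u n.+1%:R^-1.
have [n Pn] : exists n, (P (F n) < e%:E)%E.
  apply: measure_lt_bigcap => //.
  - by move=> n; exact: measurable_slab.
  - move=> n m nm; rewrite subsetEset => y [yS /andP[y0 yn]]; split=> //.
    by rewrite y0/= (le_trans yn)// lef_pV2 ?posrE// ler_nat.
  have -> : \bigcap_n F n = set0.
    rewrite -subset0 => y yF; have [yS /andP[y0 _]] := yF 0%N I.
    have [n yn] := ltr_add_invr y0; rewrite add0r in yn.
    by have [_ /andP[_]] := yF n I; rewrite leNgt yn.
  by rewrite measure0 lte_fin.
by exists n.+1%:R^-1; rewrite ?invr_gt0.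
Qed.

Definition rowspace (K : 'M[R]_d) : set 'rV[R]_d := [set y | (y <= K)%MS].

Lemma closed_rowspace (K : 'M[R]_d) : closed (rowspace K).
Proof.
have -> : rowspace K = \bigcap_(j in @setT 'I_d)
    [set y | dot y (row j (cokermx K)^T) = 0].
  apply/seteqP; split=> y; rewrite /rowspace/= submxE.
    move=> /eqP yK j _ /=; transitivity ((y *m cokermx K) ord0 j).
      by rewrite !mxE; apply: eq_bigr => i _; rewrite !mxE.
    by rewrite yK mxE.
  move=> yK; apply/eqP/rowP => j; rewrite !mxE -[RHS](yK j I).
  by apply: eq_bigr => i _; rewrite !mxE.
apply: closed_bigI => j _.
apply: (@closed_comp _ _ (fun y => dot y _) [set 0]); last exact: closed_eq.
by move=> y _; exact: continuous_dot.
Qed.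

Lemma sub_kermx_dot x u : (x <= kermx u^T)%MS = (dot x u == 0).
Proof.
rewrite (sameP sub_kermxP eqP); apply/eqP/eqP => [h|h].
  have := congr1 (fun M : 'M[R]_1 => M ord0 ord0) h; rewrite !mxE => <-.
  by apply: eq_bigr => i _; rewrite !mxE.
apply/rowP => j; rewrite !mxE -[RHS]h ord1.
by apply: eq_bigr => i _; rewrite !mxE.
Qed.

(** Induction on the dimension of the row space W of K.  Around a unit vector
    u1 of W, a halfspace with normal u is bracketed separately on the part of W
    away from the hyperplane orthogonal to u1, where the sign of <y,u> is that
    of <y,u1>, and on W meeting that hyperplane, where u may be replaced by its
    projection u'.  The projection may vanish, so the statement is about
    all vectors of W and not only unit ones. *)
Lemma finite_bracketing_rowspace (K : 'M[R]_d) (e : R) : 0 < e ->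
  exists2 F : set (set E * set E), finite_set F &
    forall u, rowspace K u -> exists2 LU, F LU &
      bracket e (rowspace K `&` sphere `&` halfspace0 u) LU.
Proof.
move: {2}(\rank K).+1 (ltnSn (\rank K)) => n; elim: n => // n IH in K e *.
rewrite ltnS => rK e0.
have mW : measurable (rowspace K `&` sphere : set E).
  apply: measurableI; last exact: measurable_sphere.
  by apply: closed_measurableRd; exact: closed_rowspace.
have cA : compact (rowspace K `&` sphere).
  apply: (subclosed_compact _ compact_sphere); last by move=> x [].
  by apply: closedI; [exact: closed_rowspace|exact: closed_sphere].
suff [F fF FP] : exists2 F : set (set E * set E), finite_set F &
    forall u, (rowspace K `&` sphere) u -> exists2 LU, F LU &
      bracket e (rowspace K `&` sphere `&` halfspace0 u) LU.
  exists (F `|` [set (rowspace K `&` sphere, rowspace K `&` sphere)]).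
    by rewrite finite_setU.
  move=> u uK; have [->|u0] := eqVneq u 0.
    exists (rowspace K `&` sphere, rowspace K `&` sphere); first by right.
    split=> //=; last by rewrite setDv measure0 lte_fin.
    by move=> y yKS; split=> //; rewrite /halfspace0/= dot0r.
  have uA : (rowspace K `&` sphere) ((enorm u)^-1 *: u).
    by split; [exact: scalemx_sub|exact: normalize_sphere].
  have [LU FLU] := FP _ uA; rewrite halfspace0Z ?invr_gt0 ?enorm_gt0// => b.
  by exists LU => //; left.
apply: compact_finite_selection cA _ => u1 [u1K u1S].
pose K' := (K :&: kermx u1^T)%MS.
have K'E y : rowspace K' y <-> rowspace K y /\ dot y u1 = 0.
  rewrite /rowspace/= sub_capmx sub_kermx_dot.
  by split=> [/andP[-> /eqP]|[-> ->]]//; rewrite eqxx.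
have rK' : (\rank K' < n)%N.
  apply: leq_trans rK; apply: rank_ltmx; rewrite ltmxE capmxSl/=.
  apply: contraPN u1S => KK' /sphereE u11.
  have /K'E[_] : rowspace K' u1 by exact: submx_trans u1K KK'.
  by rewrite u11 => /eqP; rewrite oner_eq0.
have e20 : 0 < e / 2 by rewrite divr_gt0.
have [F fF FP] := IH K' _ rK' e20.
have [del del0 Pdel] := thin_slab u1 e20.
pose LUp : set E := [set y | (rowspace K `&` sphere) y /\ del < dot y u1].
pose LUm : set E := [set y | (rowspace K `&` sphere) y /\
  (dot y u1 != 0) && (- del <= dot y u1)].
(* A bracket of the hyperplane is completed by the points that are inside for
   every u within del of u1, respectively for some such u. *)
exists [set (LU.1 `|` LUp, LU.2 `|` LUm) | LU in F]; first exact: finite_image.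
apply/nbhs_enormP; exists del => // u uu1 [uK uS].
pose u' := u - dot u u1 *: u1.
have u'u1 : dot u' u1 = 0.
  by rewrite dotBl dotZl (proj1 (sphereE u1) u1S) mulr1 subrr.
have u'K : rowspace K' u'.
  by apply/K'E; split=> //; rewrite /rowspace/= addmx_sub// -scaleNr scalemx_sub.
have [LU FLU [mL mU LA AU PLU]] := FP _ u'K.
exists (LU.1 `|` LUp, LU.2 `|` LUm); first by exists LU.
have dotu y : sphere y -> `|dot y u1 - dot y u| < del.
  move=> yS; rewrite -dotBr; apply: le_lt_trans uu1.
  exact: dot_sphere_le.
have dotu' y : dot y u1 = 0 -> dot y u' = dot y u.
  by move=> yu1; rewrite dotBr dotZr yu1 mulr0 subr0.
have mLUp : measurable LUp.
  apply: measurableI => //; apply: (@measurable_dot _ _ u1 [set r | del < r]).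
  by left; exact: open_gt.
have mLUm : measurable LUm.
  have -> : LUm = (rowspace K `&` sphere) `&` ([set y | [set r | r != 0] (dot y u1)]
      `&` [set y | [set r | - del <= r] (dot y u1)]).
    by apply/seteqP; split=> y; [case=> ? /andP[]|case=> ? [/= h1 h2]; split=> //; apply/andP].
  apply: measurableI => //; apply: measurableI; apply: measurable_dot.
    by left; exact: open_neq.
  by right; exact: closed_ge.
split=> /=.
- exact: measurableU.
- exact: measurableU.
- move=> y [/LA[[/K'E[yK yu1] yS] yu]|[[yK yS] yu1]]; split=> //.
    by rewrite /halfspace0/= -dotu'.
  rewrite /halfspace0/=; have := dotu y yS; rewrite ltr_distl => /andP[h1 h2].
  lra.
- move=> y [[yK yS]]; rewrite /halfspace0/= => yu.
  have [yu1|yu1] := eqVneq (dot y u1) 0.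
    left; apply: AU; split; first by split=> //; apply/K'E.
    by rewrite /halfspace0/= dotu'.
  right; split=> //; rewrite yu1/=.
  by have := dotu y yS; rewrite ltr_distl => /andP[h1 h2]; lra.
apply: (@le_lt_trans _ _ (P ((LU.2 `\` LU.1) `|`
    [set y | sphere y /\ 0 < `|dot y u1| <= del]))).
  apply: le_measure; rewrite ?inE//.
  - by apply: measurableD; exact: measurableU.
  - by apply: measurableU; [exact: measurableD|exact: measurable_slab].
  move=> y [[yU|[[yK yS] /andP[y0 yd]]] /not_orP[yL yLU]]; first by left.
  right; split=> //; rewrite normr_gt0 y0/= ler_norml yd/= leNgt.
  by apply/negP => yd'; apply: yLU.
apply: le_lt_trans (measureU2 _ _ _) _ => //; [exact: measurableD|exact: measurable_slab|].
by rewrite [e]splitr EFinD lteD.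
Qed.

Lemma finite_bracketing (e : R) : 0 < e ->
  exists2 F : set (set E * set E), finite_set F &
    forall u, exists2 LU, F LU & bracket e (sphere `&` halfspace0 u) LU.
Proof.
move=> e0; have [F fF FP] := finite_bracketing_rowspace 1%:M e0.
exists F => // u; have [|LU FLU] := FP u; first exact: submx1.
have -> : rowspace 1%:M = setT by apply/seteqP; split=> y _ //; exact: submx1.
by rewrite setTI => b; exists LU.
Qed.

End Bracketing.

(** * Law of large numbers for events *)

Section Count.
Context {R : realType}.

Lemma sum_inv_sq_le (n : nat) : \sum_(0 <= k < n) (k.+1%:R ^+ 2)^-1 <= 2 :> R.
Proof.
case: n => [|n]; first by rewrite big_nil.
suff : \sum_(0 <= k < n.+1) (k.+1%:R ^+ 2)^-1 <= 2 - n.+1%:R^-1 :> R.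
  by move=> /le_trans; apply; rewrite gerBl invr_ge0.
elim: n => [|n IH]; first by rewrite big_nat1 expr1n invr1; lra.
rewrite big_nat_recr//=; have : 0 < n.+1%:R :> R by [].
have -> : n.+2%:R = n.+1%:R + 1 :> R by rewrite natr1.
move: (n.+1%:R) IH => x IH x0.
apply: le_trans (lerD IH (lexx _)) _.
have -> : 2 - (x + 1)^-1 = (2 - x^-1) + (x * (x + 1))^-1.
  by field; rewrite !lt0r_neq0// addr_gt0.
by rewrite lerD2l lef_pV2 ?posrE ?exprn_gt0 ?mulr_gt0 ?addr_gt0//; nra.
Qed.

(** Between the squares k^2 and (k + 1)^2 the centered sum T n - n p moves by
    at most 2k, which is negligible with respect to k^2. *)
Lemma cvg_mean_of_squares (T : nat -> R) (p : R) :
  (forall n, 0 <= T n.+1 - T n <= 1) -> 0 <= p <= 1 ->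
  (T (k.+1 ^ 2)%N / (k.+1 ^ 2)%:R - p) @[k --> \oo] --> 0 ->
  T n.+1 / n.+1%:R @[n --> \oo] --> p.
Proof.
move=> dT p01 Tsq.
pose S n := T n - n%:R * p.
have dS m n : (m <= n)%N -> `|S n - S m| <= (n - m)%:R.
  elim: n => [|n IH]; first by rewrite leqn0 => /eqP->; rewrite subrr normr0.
  rewrite leq_eqVlt => /predU1P[->|]; first by rewrite subrr normr0 subnn.
  rewrite ltnS => mn; rewrite subSn// -natr1.
  have -> : S n.+1 - S m = (S n - S m) + (T n.+1 - T n - p).
    by rewrite /S -natr1; ring.
  apply: le_trans (ler_normD _ _) (lerD (IH mn) _).
  by have := dT n; rewrite ler_norml; lra.
apply/cvgrPdist_le => e e0.
have e20 : 0 < e / 2 by rewrite divr_gt0.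
move/cvgrPdist_le: Tsq => /(_ _ e20)[K _ HK].
have [k0 Hk0] : exists k0 : nat, 2 / k0.+1%:R < e / 2 :> R.
  have [k0] := ltr_add_invr (divr_gt0 e20 (ltr0n R 2)).
  by rewrite add0r => h; exists k0; rewrite mulrC -ltr_pdivlMr.
near=> n.
have [k /andP[kn nk]] : exists k, (k.+1 ^ 2 <= n.+1 < k.+2 ^ 2)%N.
  have ex : exists k, (n.+1 < k.+2 ^ 2)%N by exists n; rewrite expnS; nia.
  case: (ex_minnP ex) => k kn kmin; exists k; rewrite kn andbT leqNgt.
  apply/negP => nk; case: k => [|k] in kn kmin nk *; first by [].
  by have := kmin k nk; rewrite ltnn.
have kbig : (maxn K k0 <= k)%N.
  have : ((maxn K k0).+2 ^ 2 <= n)%N by near: n; exact: nbhs_infty_ge.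
  rewrite leqNgt => h; apply/negP => hk.
  suff : (k.+2 ^ 2 <= (maxn K k0).+2 ^ 2)%N by lia.
  by rewrite leq_exp2r//; lia.
move: kbig; rewrite geq_max => /andP[Kk k0k].
have := HK k Kk; rewrite /= sub0r normrN.
set m := (k.+1 ^ 2)%N => Hm.
have n0 : 0 < n.+1%:R :> R by [].
have m0 : 0 < m%:R :> R by rewrite ltr0n expn_gt0.
have -> : p - T n.+1 / n.+1%:R = - (S n.+1 / n.+1%:R).
  by rewrite /S; field; rewrite lt0r_neq0.
rewrite normrN normrM normfV (@ger0_norm _ n.+1%:R)// ler_pdivrMr//.
have Sm : `|S m| <= e / 2 * m%:R.
  have -> : S m = (T m / m%:R - p) * m%:R.
    by rewrite /S; field; rewrite lt0r_neq0.
  by rewrite normrM (gtr0_norm m0) ler_wpM2r// ltW.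
have nm : (n.+1 - m)%:R <= e / 2 * m%:R.
  apply: (@le_trans _ _ (2 * k.+1%:R)).
    by rewrite -natrM ler_nat /m; move: nk; rewrite !expnS !expn0; nia.
  have : 2 / k.+1%:R < e / 2.
    by apply: le_lt_trans Hk0; rewrite ler_pM2l// lef_pV2 ?posrE// ler_nat.
  rewrite ltr_pdivrMr// => /ltW h.
  by rewrite /m natrX expr2 mulrA ler_wpM2r.
have -> : S n.+1 = S m + (S n.+1 - S m) by rewrite addrC subrK.
apply: le_trans (ler_normD _ _) _.
apply: le_trans (lerD Sm (le_trans (dS _ _ kn) nm)) _.
by rewrite -mulrDl -splitr ler_wpM2l ?ler_nat// ltW.
Unshelve. all: by end_near. Qed.

End Count.

Section EventLLN.
Context {R : realType} {disp : measure_display} {Omega : measurableType disp}.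
Variable Pr : probability Omega R.

Lemma indic_Lfun2 (A : set Omega) : measurable A -> \1_A \in Lfun Pr 2%:E.
Proof.
move=> mA; rewrite inE/=; apply/andP; split; rewrite inE/=.
  exact: measurable_indic.
rewrite /finite_norm unlock poweR_lty//.
rewrite (_ : integral _ _ _ = \int[Pr]_x (\1_A x)%:E)%E; last first.
  apply: eq_integral => x _ /=; rewrite indicE; case: (_ \in _).
    by rewrite normr1 powR1.
  by rewrite normr0 powR0.
rewrite integral_indic// setIT.
exact: le_lt_trans (probability_le1 Pr mA) (ltry _).
Qed.

Variable A : nat -> set Omega.
Hypothesis mA : forall i, measurable (A i).

Definition event_count (n : nat) : Omega -> R := fun w => \sum_(i < n) \1_(A i) w.

Lemma measurable_event_count n : measurable_fun setT (event_count n).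
Proof. by apply: measurable_sum => i; exact: measurable_indic. Qed.

Variable p : R.
Hypothesis PA : forall i, Pr (A i) = p%:E.
Hypothesis PAA : forall i j, i != j -> Pr (A i `&` A j) = (p * p)%:E.

Lemma event_countS n : event_count n.+1 = (event_count n \+ \1_(A n))%R.
Proof. by apply/funext => w; rewrite /event_count big_ord_recr. Qed.

Lemma event_count0 : event_count 0 = cst 0.
Proof. by apply/funext => w; rewrite /event_count big_ord0. Qed.

Lemma event_count_Lfun2 n : event_count n \in Lfun Pr 2%:E.
Proof.
elim: n => [|n IH]; first by rewrite event_count0 Lfun_cst.
have h : (1 <= 2%:E :> \bar R)%E by rewrite lee1n.
by rewrite event_countS; apply: (proj2 (Lfun_addr_closed Pr h)) => //; exact: indic_Lfun2.
Qed.

Let Pfin : Pr setT \is a fin_num := fin_num_measure Pr _ measurableT.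

Lemma expectation_event_count n : ('E_Pr[event_count n] = (n%:R * p)%:E)%E.
Proof.
elim: n => [|n IH]; first by rewrite event_count0 expectation_cst mul0r.
rewrite event_countS expectationD ?Lfun_subset12 ?event_count_Lfun2 ?indic_Lfun2//.
by rewrite IH expectation_indic// PA -EFinD -natr1 mulrDl mul1r.
Qed.

Lemma covariance_indic i j :
  covariance Pr \1_(A i) \1_(A j) = (if i == j then p - p * p else 0)%:E.
Proof.
have L2 k := indic_Lfun2 (mA k).
rewrite covarianceE ?Lfun2_mul_Lfun1 ?Lfun_subset12//.
have -> : (\1_(A i) * \1_(A j) : Omega -> R) = \1_(A i `&` A j).
  by rewrite indicI.
rewrite !expectation_indic//; last exact: measurableI.
rewrite !PA -EFinM; have [->|ij] := eqVneq i j.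
  by rewrite setIid PA -EFinB.
by rewrite PAA// -EFinB subrr.
Qed.

Lemma variance_event_count n : ('V_Pr[event_count n] = (n%:R * (p - p * p))%:E)%E.
Proof.
have L2 k := indic_Lfun2 (mA k).
have cov m k : (k <= m)%N -> covariance Pr (event_count k) \1_(A m) = 0%E.
  elim: k => [_|k IH km]; first by rewrite event_count0 covariance_cst_l.
  rewrite event_countS covarianceDl ?event_count_Lfun2//.
  by rewrite (IH (ltnW km)) add0e (covariance_indic k m) (ltn_eqF km).
elim: n => [|n IH]; first by rewrite event_count0 variance_cst mul0r.
rewrite event_countS varianceD ?event_count_Lfun2// cov// mule0 adde0 IH.
by rewrite /variance covariance_indic eqxx -EFinD -natr1 mulrDl mul1r.
Qed.

(** The variance of the frequency among the first k^2 events is at most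
    k^(-2), so the sum over k of the squared deviations has finite expectation;
    it is therefore almost surely finite and its terms tend to 0. *)
Lemma event_lln :
  {ae Pr, forall w, event_count n.+1 w / n.+1%:R @[n --> \oo] --> p}.
Proof.
have p01 : 0 <= p <= 1.
  by rewrite -!lee_fin -(PA 0%N) measure_ge0 probability_le1.
have mT := measurable_event_count.
pose f k w : \bar R := ((event_count (k.+1 ^ 2)%N w / (k.+1 ^ 2)%:R - p) ^+ 2)%:E.
have mf k : measurable_fun setT (f k).
  apply/measurable_EFinP; apply: measurable_funX; apply: measurable_funB => //.
  by apply: measurable_funM.
have f0 k w : (0 <= f k w)%E by rewrite lee_fin sqr_ge0.
have intf k : (\int[Pr]_w f k w <= ((k.+1%:R ^+ 2)^-1)%:E)%E.
  pose m := (k.+1 ^ 2)%N; have m0 : 0 < m%:R :> R by rewrite ltr0n expn_gt0.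
  have -> : (\int[Pr]_w f k w = (m%:R ^- 2)%:E * 'V_Pr[event_count m])%E.
    rewrite /variance unlock expectation_event_count.
    rewrite unlock.
    rewrite -ge0_integralZl_EFin//; last 2 first.
    - by move=> w _; rewrite lee_fin -expr2 sqr_ge0.
    - by apply/measurable_EFinP; apply: measurable_funM; apply: measurable_funB.
    apply: eq_integral => w _; rewrite /f -EFinM/= !fctE.
    congr (_%:E); rewrite -/m /=.
    by field; rewrite lt0r_neq0.
  rewrite variance_event_count -EFinM lee_fin.
  have -> : m%:R ^- 2 * (m%:R * (p - p * p)) = (p - p * p) * m%:R^-1.
    by field; rewrite lt0r_neq0.
  rewrite -natrX -[leRHS]mul1r ler_wpM2r ?invr_ge0 ?ler0n//; nra.
have intS : (\int[Pr]_w (\sum_(0 <= k <oo) f k w) < +oo)%E.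
  rewrite integral_nneseries//.
  apply: (@le_lt_trans _ _ 2%:E); last exact: ltry.
  apply: lime_le.
    by apply: is_cvg_nneseries => k _ _; apply: integral_ge0.
  apply: nearW => n.
  apply: le_trans (lee_sum _ (fun k _ => intf k)) _.
  by rewrite sumEFin lee_fin sum_inv_sq_le.
have intbl : Pr.-integrable setT (fun w => (\sum_(0 <= k <oo) f k w)%E).
  apply/integrableP; split; first exact: ge0_emeasurable_sum.
  under eq_integral do rewrite gee0_abs ?nneseries_ge0//.
  exact: intS.
have := integrable_ae measurableT intbl.
apply: filterS => w /(_ I) fw.
apply: (@cvg_mean_of_squares _ (event_count ^~ w)) => //.
  move=> n; rewrite event_countS /= addrAC subrr add0r indicE.
  by case: (_ \in _); rewrite ?lexx ?ler01.
have : series (fun k => fine (f k w)) @ \oo --> fine (\sum_(0 <= k <oo) f k w)%E.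
  have := @is_cvg_nneseries _ (f ^~ w) xpredT 0%N (fun k _ _ => f0 k w).
  move=> /cvg_ex[l cl]; have el := cvg_lim (@ereal_hausdorff R) cl.
  move: cl; rewrite -el -(fineK fw) => /fine_cvg; apply: cvg_trans.
  apply: near_eq_cvg; apply: nearW => n /=.
  by rewrite sumEFin.
move=> /cvgP/cvg_series_cvg_0 h.
have {}h : Num.sqrt (fine (f k w)) @[k --> \oo] --> 0.
  by rewrite -sqrtr0; exact: (continuous_cvg _ (@sqrt_continuous R 0) h).
apply: norm_cvg0; apply: cvg_trans h; apply: near_eq_cvg; apply: nearW => k.
by rewrite /f/= sqrtr_sqr.
Qed.

End EventLLN.

(** * Elementary properties of the depth *)

Section Depth.
Context {R : realType} {d : nat}.
Local Notation E := (borelRd R d).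
Implicit Types (Q : {measure set E -> \bar R}) (x y u v : 'rV[R]_d).

(** Common to P and to the empirical measures, the latter being bare measures
    and not bundled probabilities. *)
Definition sphere_proba Q : Prop := Q setT = 1%E /\ Q sphere = 1%E.

Definition hmass Q u : R := fine (Q (halfspace0 u)).

Lemma hmassZ Q a u : 0 < a -> hmass Q (a *: u) = hmass Q u.
Proof. by move=> a0; rewrite /hmass halfspace0Z. Qed.

Section OneMeasure.
Variable Q : {measure set E -> \bar R}.
Hypothesis hQ : sphere_proba Q.

Lemma sphere_proba_le1 (A : set E) : measurable A -> (Q A <= 1)%E.
Proof. by move=> mA; rewrite -(proj1 hQ) le_measure ?inE. Qed.

Lemma sphere_proba_fin (A : set E) : measurable A -> Q A \is a fin_num.
Proof.
move=> mA; rewrite ge0_fin_numE//.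
exact: le_lt_trans (sphere_proba_le1 mA) (ltry _).
Qed.

Lemma sphere_proba_finite : (Q setT < +oo)%E.
Proof. by rewrite (proj1 hQ) ltry. Qed.

Lemma sphere_probaI (A : set E) : measurable A -> Q (sphere `&` A) = Q A.
Proof.
move=> mA; have mS := @measurable_sphere R d.
have SC0 : Q (setT `\` sphere) = 0%E.
  have : (1 = Q (setT `\` sphere) + 1)%E.
    rewrite -[LHS](proj1 hQ) -[X in (_ = _ + X)%E](proj2 hQ).
    by have := measureDI Q measurableT mS; rewrite setTI.
  have := sphere_proba_fin (measurableD measurableT mS).
  case: (Q _) => //= r _ /eqP; rewrite -EFinD eqe => /eqP h.
  by congr (_%:E); lra.
rewrite [RHS](measureDI Q mA mS) [X in (X + _)%E](_ : _ = 0%E).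
  by rewrite add0e setIC.
apply/eqP; rewrite -measure_le0 -SC0; apply: le_measure; rewrite ?inE//.
- exact: measurableD.
- exact: measurableD.
- by move=> y [].
Qed.

Lemma hmass_ge0 u : 0 <= hmass Q u.
Proof. exact: fine_ge0. Qed.

Lemma hmass_le1 u : hmass Q u <= 1.
Proof.
have mH := @measurable_halfspace0 R d u.
by rewrite /hmass -lee_fin fineK ?sphere_proba_fin ?sphere_proba_le1.
Qed.

Lemma hmassE u : (hmass Q u)%:E = Q (sphere `&` halfspace0 u).
Proof.
have mH := @measurable_halfspace0 R d u.
by rewrite sphere_probaI// fineK// sphere_proba_fin.
Qed.

(** A point with <y,u> < 0 stays outside the halfspaces of nearby normals, so
    these halfspaces exceed that of u by at most a thin layer of points with
    -1/n <= <y,u> < 0. *)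
Lemma hmass_usc u (c : R) : hmass Q u < c ->
  exists2 del : R, 0 < del & forall v, enorm (u - v) < del -> hmass Q v < c.
Proof.
move=> uc; pose F n : set E := sphere `&` [set y | - n.+1%:R^-1 <= dot y u].
have mF n : measurable (F n).
  apply: measurableI; first exact: measurable_sphere.
  apply: (@measurable_dot _ _ u [set r | - n.+1%:R^-1 <= r]); right.
  exact: closed_ge.
have [n Fn] : exists n, (Q (F n) < c%:E)%E.
  apply: measure_lt_bigcap => //; first exact: sphere_proba_finite.
    move=> n m nm; rewrite subsetEset => y [yS /= yn]; split=> //=.
    by apply: le_trans yn; rewrite lerN2 lef_pV2 ?posrE// ler_nat.
  apply: (@le_lt_trans _ _ (hmass Q u)%:E); last by rewrite lte_fin.
  rewrite hmassE; apply: le_measure; rewrite ?inE.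
  - exact: bigcapT_measurable.
  - apply: measurableI; first exact: measurable_sphere.
    exact: measurable_halfspace0.
  move=> y yF; split; first by have [] := yF 0%N I.
  rewrite /halfspace0/= leNgt; apply/negP => yu0.
  have [n yn] := ltr_add_invr yu0; have [_ /= yn'] := yF n I.
  by move: yn; rewrite ltNge -lerBlDr sub0r yn'.
exists n.+1%:R^-1; first by rewrite invr_gt0.
move=> v uv; rewrite -lte_fin hmassE; apply: le_lt_trans Fn.
apply: le_measure; rewrite ?inE//.
  apply: measurableI; first exact: measurable_sphere.
  exact: measurable_halfspace0.
move=> y [yS yv]; split=> //; rewrite /halfspace0/= in yv.
change (- n.+1%:R^-1 <= dot y u); move: (n.+1%:R^-1) uv => del uv.
have := le_lt_trans (dot_sphere_le (u - v) yS) uv.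
by rewrite dotBr ltr_norml => /andP[h _]; lra.
Qed.

Lemma ahD_set_nonempty x : sphere x ->
  [set fine (Q (halfspace0 u)) | u in [set u | sphere u /\ halfspace0 u x]] !=set0.
Proof.
move=> xS; exists (hmass Q x); exists x => //; split=> //.
exact: dotxx_ge0.
Qed.

Lemma ahD_le x u : sphere u -> halfspace0 u x -> ahD Q x <= hmass Q u.
Proof.
move=> uS xu; apply: ge_inf; last by exists u.
by exists 0 => _ [v _ <-]; exact: hmass_ge0.
Qed.

Lemma ahD_ge x c : sphere x ->
  (forall u, sphere u -> halfspace0 u x -> c <= hmass Q u) -> c <= ahD Q x.
Proof.
move=> xS h; apply: lb_le_inf; first exact: ahD_set_nonempty.
by move=> _ [u [uS xu] <-]; exact: h.
Qed.

Lemma ahD_ge0 x : sphere x -> 0 <= ahD Q x.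
Proof. by move=> xS; apply: ahD_ge => // u _ _; exact: hmass_ge0. Qed.

Lemma ahD_le1 x : sphere x -> ahD Q x <= 1.
Proof.
move=> xS; apply: le_trans (hmass_le1 x); apply: ahD_le => //.
exact: dotxx_ge0.
Qed.

(** The constraint <x,u> >= 0 of the infimum can be made strict: pushing u
    towards x makes <x,u> positive and, by upper semicontinuity, does not raise
    the mass above c.  All conditions are then open in u, and a rational u does.
    This is the source of both the upper semicontinuity of the depth and the
    measurability of depth events. *)
Lemma ahD_ltP x c : sphere x ->
  ahD Q x < c <-> exists q, 0 < dot x (ratv q) /\ hmass Q (ratv q) < c.
Proof.
move=> xS; split=> [/inf_lt|[q [xq qc]]].
  move=> /(_ (ahD_set_nonempty xS))[_ [u [uS xu] <-] uc].
  have [del del0 hdel] := hmass_usc uc.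
  have del20 : 0 < del / 2 by rewrite divr_gt0.
  have [q uq] := @dense_ratv _ _ (u + (del / 2) *: x) _ del20.
  (* Moving by del / 2 towards x makes the product with x at least del / 2; the
     rational approximation then costs less than del / 2. *)
  exists q; split.
    have := dot_sphere_le (u + (del / 2) *: x - ratv q) xS.
    rewrite dotBr dotDr dotZr (proj1 (sphereE x) xS) mulr1 ler_norml.
    by move=> /andP[_ h]; move: xu; rewrite /halfspace0/=; lra.
  apply: hdel; rewrite [del]splitr.
  apply: le_lt_trans (enorm_triangle (u + (del / 2) *: x) _ _) _.
  apply: ler_ltD => //.
  by rewrite opprD addrA subrr sub0r enormN enormZ xS mulr1 gtr0_norm.
have q0 : ratv q != 0 :> 'rV[R]_d.
  by apply: contraTneq xq => ->; rewrite dot0r ltxx.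
have nq0 : 0 < (enorm (ratv q : 'rV[R]_d))^-1 by rewrite invr_gt0 enorm_gt0.
apply: le_lt_trans qc; rewrite -(hmassZ _ _ nq0); apply: ahD_le.
  exact: normalize_sphere.
by rewrite /halfspace0/= dotZr mulr_ge0 ?ltW.
Qed.

Lemma ahD_usc x c : sphere x -> ahD Q x < c ->
  exists2 e : R, 0 < e & forall y, sphere y -> enorm (x - y) < e -> ahD Q y < c.
Proof.
move=> xS /(ahD_ltP _ xS)[q [xq qc]].
have q0 : ratv q != 0 :> 'rV[R]_d.
  by apply: contraTneq xq => ->; rewrite dot0r ltxx.
have nq0 : 0 < enorm (ratv q : 'rV[R]_d) by rewrite enorm_gt0.
exists (dot x (ratv q) / enorm (ratv q)); first by rewrite divr_gt0.
move=> y yS; rewrite ltr_pdivlMr// => xy.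
apply/ahD_ltP => //; exists q; split=> //.
have := cauchy_schwarz (x - y) (ratv q).
by rewrite dotBl ler_norml => /andP[_ h]; lra.
Qed.

End OneMeasure.

(** Two infima over the same index set differ by at most the uniform distance
    of the functions. *)
Lemma ahD_uniform Q P (e : R) :
  (forall u, sphere u -> `|hmass Q u - hmass P u| <= e) ->
  forall x, sphere x -> `|ahD Q x - ahD P x| <= e.
Proof.
move=> h.
have one Q1 Q2 x : sphere x ->
    (forall u, sphere u -> `|hmass Q1 u - hmass Q2 u| <= e) ->
    ahD Q1 x - e <= ahD Q2 x.
  move=> xS h12; apply: ahD_ge => // u uS xu.
  have := ahD_le Q1 uS xu; have := le_trans (ler_norm _) (h12 u uS).
  by lra.
move=> x xS; rewrite ler_distl -[X in _ && X]lerBlDr; apply/andP; split.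
  by apply: one => // u uS; rewrite distrC h.
exact: one.
Qed.

Lemma ahD_dist_has_ubound Q P : sphere_proba Q -> sphere_proba P ->
  has_ubound [set `|ahD Q x - ahD P x| | x in sphere].
Proof.
move=> hQ hP; exists 1 => _ [y yS <-]; rewrite ler_norml.
have := ahD_ge0 Q yS; have := ahD_ge0 P yS.
by have := ahD_le1 hQ yS; have := ahD_le1 hP yS; lra.
Qed.

End Depth.

(** * Empirical measures *)

Section Empirical.
Context {R : realType} {d : nat}.
Local Notation E := (borelRd R d).

Lemma empiricalE n (x : nat -> E) (B : set E) :
  empirical n x B = ((\sum_(i < n) \1_B (x i)) / n%:R)%:E.
Proof.
rewrite /empirical /mscale/= /msum/= mulrC EFinM -sumEFin; congr (_ * _)%E.
Qed.

Variables (n : nat) (x : nat -> E).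
Hypothesis xS : forall i, sphere (x i).

Lemma empirical_sphere_proba : sphere_proba (empirical n.+1 x).
Proof.
have full (B : set E) : (forall i, B (x i)) -> empirical n.+1 x B = 1%E.
  move=> xB; rewrite empiricalE (eq_bigr (fun=> 1)).
    by rewrite sumr_const card_ord divff.
  by move=> i _; rewrite indicE mem_set.
by split; apply: full.
Qed.

Lemma hmass_empirical_level u :
  exists k : nat, hmass (empirical n.+1 x) u = k%:R / n.+1%:R.
Proof.
exists (\sum_(i < n.+1) (x i \in halfspace0 u : bool))%N.
by rewrite /hmass empiricalE natr_sum.
Qed.

(** The depth is an infimum over finitely many values, hence attained. *)
Lemma ahD_empirical_level z : sphere z ->
  exists k : nat, ahD (empirical n.+1 x) z = k%:R / n.+1%:R.
Proof.
move=> zS; have n0 : 0 < n.+1%:R :> R by [].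
pose A k := `[< exists u, [/\ sphere u, halfspace0 u z &
                  hmass (empirical n.+1 x) u = k%:R / n.+1%:R] >].
have exA : exists k, A k.
  have [k zk] := hmass_empirical_level z.
  by exists k; apply/asboolP; exists z; split=> //; exact: dotxx_ge0.
have [k /asboolP[u [uS zu uk]] kmin] := ex_minnP exA; exists k.
apply/eqP; rewrite eq_le; apply/andP; split; first by rewrite -uk ahD_le.
apply: ahD_ge => // v vS zv; have [m vm] := hmass_empirical_level v.
rewrite vm ler_pM2r ?invr_gt0// ler_nat; apply: kmin.
by apply/asboolP; exists v.
Qed.

Lemma empirical_ahD_max : exists2 z, sphere z &
  ahD (empirical n.+1 x) z = ahD_max (empirical n.+1 x).
Proof.
have n0 : 0 < n.+1%:R :> R by [].
have hn := empirical_sphere_proba.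
pose A k := `[< exists2 z, sphere z & ahD (empirical n.+1 x) z = k%:R / n.+1%:R >].
have exA : exists k, A k.
  have [k zk] := ahD_empirical_level (xS 0%N).
  by exists k; apply/asboolP; exists (x 0%N).
have bA k : A k -> (k <= n.+1)%N.
  move=> /asboolP[z zS zk]; have := ahD_le1 hn zS.
  by rewrite zk ler_pdivrMr// mul1r ler_nat.
have [k /asboolP[z zS zk] kmax] := ex_maxnP exA bA; exists z => //.
apply/eqP; rewrite eq_le; apply/andP; split.
  apply: ub_le_sup; last by exists z.
  by exists 1 => _ [y yS <-]; exact: ahD_le1.
apply: ge_sup; first by exists (ahD (empirical n.+1 x) z), z.
move=> _ [y yS <-]; have [m ym] := ahD_empirical_level yS.
rewrite ym zk ler_pM2r ?invr_gt0// ler_nat; apply: kmax.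
by apply/asboolP; exists y.
Qed.

End Empirical.

(** * Stability of regions and medians under uniform perturbation of the depth *)

Section Hausdorff.
Context {R : realType} {d : nat}.
Implicit Types (K L : set 'rV[R]_d).

Lemma hausdorff_dist_ge0 K L : L !=set0 -> (0 <= hausdorff_dist K L)%E.
Proof.
move=> [y Ly]; rewrite /hausdorff_dist le_max; apply/orP; right.
apply: le_ereal_sup_tmp; exists (ereal_inf [set (enorm (y - z))%:E | z in K]).
  by exists y.
by apply: le_ereal_inf_tmp => _ [z _ <-]; rewrite lee_fin enorm_ge0.
Qed.

Lemma hausdorff_dist_le K L (t : R) :
  (forall x, K x -> exists2 y, L y & enorm (x - y) <= t) ->
  (forall x, L x -> exists2 y, K y & enorm (x - y) <= t) ->
  (hausdorff_dist K L <= t%:E)%E.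
Proof.
have half A B : (forall x, A x -> exists2 y, B y & enorm (x - y) <= t) ->
  (ereal_sup [set ereal_inf [set (enorm (x - y))%:E | y in B] | x in A] <= t%:E)%E.
  move=> h; apply: ge_ereal_sup => _ [x Ax <-]; have [y By xy] := h x Ax.
  by apply: ge_ereal_inf; exists (enorm (x - y))%:E; [exists y|rewrite lee_fin].
by move=> hK hL; rewrite /hausdorff_dist ge_max !half.
Qed.

Lemma cvge0P (f : nat -> \bar R) : (forall n, 0 <= f n)%E ->
  (forall t : R, 0 < t -> \forall n \near \oo, (f n <= t%:E)%E) ->
  f @ \oo --> 0%E.
Proof.
move=> f0 h; apply/fine_cvgP; split.
  apply: filterS (h 1 ltr01) => n fn; rewrite ge0_fin_numE//.
  exact: le_lt_trans fn (ltry _).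
apply/cvgrPdist_le => e e0; apply: filterS (h e e0) => n fn /=.
rewrite sub0r normrN ger0_norm ?fine_ge0// -lee_fin fineK//.
by rewrite ge0_fin_numE//; exact: le_lt_trans fn (ltry _).
Qed.

End Hausdorff.

Section Stability.
Context {R : realType} {d : nat}.
Local Notation E := (borelRd R d).
Variable P : {measure set E -> \bar R}.
Hypothesis hP : sphere_proba P.
Implicit Types (Q : {measure set E -> \bar R}) (x y : 'rV[R]_d).

Lemma sphere_proba_nonempty : (sphere : set 'rV[R]_d) !=set0.
Proof.
apply/set0P/eqP => S0; have := proj2 hP; rewrite S0 measure0 => /eqP.
by rewrite eqe eq_sym oner_eq0.
Qed.

Lemma ahD_le_max x : sphere x -> ahD P x <= ahD_max P.
Proof.
move=> xS; apply: ub_le_sup; last by exists x.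
by exists 1 => _ [y yS <-]; exact: ahD_le1.
Qed.

Lemma ahD_region_nonempty alpha :
  alpha < ahD_max P -> ahD_region P alpha !=set0.
Proof.
move=> /sup_gt[|_ [x xS <-] /ltW xa]; last by exists x.
by have [x xS] := sphere_proba_nonempty; exists (ahD P x), x.
Qed.

(** Locally around (x, alpha): if the depth of x is below alpha, it
    stays below near x by upper semicontinuity and there is nothing to prove;
    otherwise x is a limit of points of depth greater than alpha, and one of
    them serves for all nearby points and levels.  A common margin e exists by
    compactness. *)
Lemma strictly_monotone_uniform (a b t : R) : strictly_monotone P ->
  `[a, b] `<=` `]ahD_min P, ahD_max P[ -> 0 < t ->
  exists2 e : R, 0 < e & forall alpha x, a <= alpha <= b -> sphere x ->
    alpha - e <= ahD P x ->
    exists2 y, sphere y /\ alpha + e <= ahD P y & enorm (x - y) <= t.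
Proof.
move=> mono ab t0.
pose K : set ('rV[R]_d * R) := sphere `*` `[a, b].
have /compact_near_coveringP cK : compact K.
  by apply: compact_setX; [exact: compact_sphere|exact: segment_compact].
pose good (e : R) (p : 'rV[R]_d * R) := sphere p.1 -> p.2 - e <= ahD P p.1 ->
    exists2 y, sphere y /\ p.2 + e <= ahD P y & enorm (p.1 - y) <= t.
have loc x alpha r g : 0 < r -> 0 < g ->
    (forall x' alpha' e, enorm (x - x') < r -> `|alpha - alpha'| < g ->
       0 < e < g -> good e (x', alpha')) ->
    \forall p \near (x, alpha) & e \near 0^'+, good e p.
  move=> r0 g0 h.
  exists ([set p : 'rV[R]_d * R | enorm (x - p.1) < r /\ `|alpha - p.2| < g],
          [set e : R | 0 < e < g]).
    split=> /=; last first.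
      by apply: filterS2 (nbhs_right_gt 0) (nbhs_right_lt g0) => e /= -> ->.
    exists ([set y | enorm (x - y) < r], [set c | `|alpha - c| < g]).
      split; first by apply/nbhs_enormP; exists r.
      by apply/nbhs_ballP; exists g.
    by move=> [y c] [].
  by move=> [[y c] e] /= [[yr cg] eg]; exact: h.
have /cK : forall p, K p -> \forall p' \near p & e \near 0^'+, good e p'.
  move=> [x alpha] [/= xS xab].
  have [xa|ax] := ltP (ahD P x) alpha.
    pose g := alpha - ahD P x; have g0 : 0 < g by rewrite subr_gt0.
    have [|r r0 hr] := @ahD_usc _ _ _ hP x (alpha - g / 2) xS.
      by rewrite /g; lra.
    (* The margin g / 2 pays for the changes of alpha and of e, less than g / 8
       each. *)
    apply: (loc _ _ r (g / 8)) => //; first by rewrite divr_gt0.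
    move=> x' alpha' e /hr xr; rewrite ltr_norml => a' e0 x'S /= x'a.
    by have := xr x'S; lra.
  have : ahD_region P alpha x by [].
  rewrite mono; last by have := ab _ xab; rewrite /= in_itv.
  have t20 : 0 < t / 2 by rewrite divr_gt0.
  move=> /(_ [set y | enorm (x - y) < t / 2])[|y [[yS ay] xy]].
    by apply/nbhs_enormP; exists (t / 2).
  pose g := ahD P y - alpha; have g0 : 0 < g by rewrite subr_gt0.
  apply: (loc _ _ (t / 2) (g / 4)) => //; first by rewrite divr_gt0.
  move=> x' alpha' e xx'; rewrite ltr_norml => a' e0 x'S /= x'a.
  exists y; first by split=> //; rewrite /g in a' e0; lra.
  apply: le_trans (enorm_triangle x _ _) _; rewrite /= in xy.
  by rewrite enorm_sub_sym; lra.
move=> h; have [e [Ke e0]] : exists e, (K `<=` good e) /\ 0 < e.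
  apply: (@filter_ex _ (0^'+ : set_system R)).
  by apply: filterI h _; exact: nbhs_right_gt.
by exists e => // alpha x axb xS; apply: (Ke (x, alpha)).
Qed.

(** The margin is used on both sides: alpha - e absorbs the error on the given
    point, alpha + e the error on the point found near it. *)
Lemma region_stability (a b t : R) : strictly_monotone P ->
  `[a, b] `<=` `]ahD_min P, ahD_max P[ -> 0 < t ->
  exists2 e : R, 0 < e & forall Q,
    (forall x, sphere x -> `|ahD Q x - ahD P x| <= e) ->
    forall alpha, a <= alpha <= b ->
      (hausdorff_dist (ahD_region Q alpha) (ahD_region P alpha) <= t%:E)%E.
Proof.
move=> mono ab t0; have [e e0 he] := strictly_monotone_uniform mono ab t0.
exists e => // Q hQ alpha aab; apply: hausdorff_dist_le => x [xS xa].
  have [|y [yS ya] xy] := he alpha x aab xS.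
    by have := hQ x xS; rewrite ler_norml; lra.
  by exists y => //; split=> //; lra.
have [|y [yS ya] xy] := he alpha x aab xS; first by lra.
exists y => //; split=> //.
by have := hQ y yS; rewrite ler_norml; lra.
Qed.

(** By upper semicontinuity and compactness, depth within 2e of the maximum
    forces a point to be within t of m.  A median x of Q is such a point: the depths
    of x and m change by at most e, and x does at least as well as m for Q. *)
Lemma median_stability (m : 'rV[R]_d) (t : R) : medians P = [set m] -> 0 < t ->
  exists2 e : R, 0 < e & forall Q,
    (forall x, sphere x -> `|ahD Q x - ahD P x| <= e) ->
    medians Q !=set0 -> (forall x, sphere x -> ahD Q x <= ahD_max Q) ->
    (hausdorff_dist (medians Q) (medians P) <= t%:E)%E.
Proof.
move=> Pm t0.
have [mS mmax] : medians P m by rewrite Pm.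
have /compact_near_coveringP cS := @compact_sphere R d.
pose good (e : R) (x : 'rV[R]_d) :=
  sphere x -> ahD_max P - 2 * e <= ahD P x -> enorm (x - m) <= t.
have /cS : forall x, sphere x -> \forall x' \near x & e \near 0^'+, good e x'.
  move=> x xS; have [->|xm] := eqVneq x m.
    exists ([set y | enorm (m - y) < t], setT) => /=.
      by split; [apply/nbhs_enormP; exists t|exact: filterT].
    by move=> [y e] /= [yt _] _ _; rewrite enorm_sub_sym ltW.
  have xmax : ahD P x < ahD_max P.
    rewrite lt_neqAle ahD_le_max// andbT; apply/eqP => xmax.
    have : medians P x by [].
    by rewrite Pm /= => /eqP; exact/negP.
  pose g := ahD_max P - ahD P x; have g0 : 0 < g by rewrite subr_gt0.
  have [|r r0 hr] := @ahD_usc _ _ _ hP x (ahD_max P - g / 2) xS.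
    by rewrite /g; lra.
  exists ([set y | enorm (x - y) < r], [set e : R | e < g / 4]) => /=.
    split; first by apply/nbhs_enormP; exists r.
    by apply: nbhs_right_lt; rewrite divr_gt0.
  by move=> [y e] /= [yr eg] yS ye; have := hr y yS yr; lra.
move=> h; have [e [Ke e0]] : exists e, (sphere `<=` good e) /\ 0 < e.
  apply: (@filter_ex _ (0^'+ : set_system R)).
  by apply: filterI h _; exact: nbhs_right_gt.
exists e => // Q hQ [z zQ] Qmax.
have near_m x : medians Q x -> enorm (x - m) <= t.
  move=> [xS xmax]; apply: (Ke x xS xS).
  have := hQ x xS; have := hQ m mS; have := Qmax m mS.
  by rewrite !ler_norml xmax mmax; lra.
apply: hausdorff_dist_le => x.
  by move=> /near_m xm; exists m; rewrite ?Pm.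
by rewrite Pm => ->; exists z => //; rewrite enorm_sub_sym; exact: near_m.
Qed.

End Stability.

(** * Measurability of the convergence events *)

Section MeasurableSets.
Context {R : realType} {disp : measure_display} {Omega : measurableType disp}.
Implicit Types F : set Omega.

Lemma measurable_exists (I : countType) (F : I -> set Omega) :
  (forall i, measurable (F i)) -> measurable [set w | exists i, F i w].
Proof.
move=> mF; rewrite (_ : mkset _ = \bigcup_i F i).
  by apply: countable_bigcupT_measurable; [exact: countableP|exact: mF].
by apply/seteqP; split=> w [i] => [|_]; exists i.
Qed.

Lemma measurable_cst_set (b : Prop) : measurable [set _ : Omega | b].
Proof.
have [hb|hb] := pselect b.
  by have -> : [set _ : Omega | b] = setT by apply/seteqP; split.
by have -> : [set _ : Omega | b] = set0 by apply/seteqP; split.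
Qed.

Lemma measurable_cond (b : Prop) F : measurable F -> measurable [set w | b /\ F w].
Proof. by move=> mF; apply: (measurableI _ _ (measurable_cst_set b)). Qed.

Lemma measurable_cvge0 (f : nat -> Omega -> \bar R) :
  (forall n w, 0 <= f n w)%E ->
  (forall n (t : R), 0 < t -> measurable [set w | (t%:E < f n w)%E]) ->
  measurable [set w | f n w @[n --> \oo] --> 0%E].
Proof.
move=> f0 mf.
rewrite (_ : mkset _ = \bigcap_m \bigcup_N \bigcap_(n in [set n | (N <= n)%N])
    ~` [set w | ((m.+1%:R^-1)%:E < f n w)%E]).
  apply: bigcapT_measurable => m; apply: bigcupT_measurable => N.
  apply: bigcap_measurable => [|n _]; first by exists N => /=.
  apply: measurableC; apply: mf.
  by rewrite invr_gt0.
apply/seteqP; split=> w /=.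
  move=> /fine_cvgP[[N1 _ ffin] /cvgrPdist_le fw] m _.
  have [|N2 _ fN] := fw (m.+1%:R^-1); first by rewrite invr_gt0.
  exists (maxn N1 N2) => // n /=; rewrite geq_max => /andP[N1n N2n].
  have := fN n N2n; rewrite /= sub0r normrN ger0_norm ?fine_ge0//.
  by rewrite -lee_fin fineK ?ffin// leNgt => /negP.
move=> h; apply: cvge0P => // t t0.
have [m mt] := ltr_add_invr t0; rewrite add0r in mt.
have [N _ fN] := h m I; exists N => // n /= Nn.
apply: (@le_trans _ _ (m.+1%:R^-1)%:E); last by rewrite lee_fin ltW.
by rewrite leNgt; apply/negP; exact: fN.
Qed.

End MeasurableSets.

Section Far.
Context {R : realType} {d : nat}.
Implicit Types (K L : set 'rV[R]_d) (x : 'rV[R]_d) (t : R).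

(** The distance from x to K exceeds t, with a witness in place of the infimum;
    every x is far from the empty set, whose distance is +oo. *)
Definition far t K x : Prop :=
  exists2 s : R, t < s & forall y, K y -> s <= enorm (x - y).

Lemma farP t K x :
  (t%:E < ereal_inf [set (enorm (x - y))%:E | y in K])%E <-> far t K x.
Proof.
split=> [h|[s ts hs]]; last first.
  apply: (@lt_le_trans _ _ s%:E); first by rewrite lte_fin.
  by apply: le_ereal_inf_tmp => _ [y Ky <-]; rewrite lee_fin hs.
have [s [ts hs]] : exists s, t < s /\
    (s%:E <= ereal_inf [set (enorm (x - y))%:E | y in K])%E.
  case: (ereal_inf _) h => [r| |]//.
    by rewrite lte_fin => tr; exists r.
  by move=> _; exists (t + 1); split; [lra|rewrite leey].
exists s => // y Ky; rewrite -lee_fin; apply: le_trans hs _.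
by apply: ereal_inf_lbound; exists y.
Qed.

Lemma lt_hausdorff_distP t K L : (t%:E < hausdorff_dist K L)%E <->
  (exists2 x, K x & far t L x) \/ (exists2 x, L x & far t K x).
Proof.
have half A B :
  (t%:E < ereal_sup [set ereal_inf [set (enorm (x - y))%:E | y in B] | x in A])%E
    <-> exists2 x, A x & far t B x.
  split=> [/ereal_sup_gt[_ [x Ax <-] /farP]|[x Ax /farP xB]]; first by exists x.
  by apply: lt_le_trans xB _; apply: ereal_sup_ubound; exists x.
rewrite /hausdorff_dist lt_max; split.
  by move=> /orP[/half|/half]; [left|right].
by move=> [/half ->|/half ->]; rewrite ?orbT.
Qed.

Lemma open_far t K : open (far t K).
Proof.
apply/open_enormP => x [s ts hs]; exists ((s - t) / 2).
  by rewrite divr_gt0 ?subr_gt0.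
move=> y xy; exists ((s + t) / 2); first by lra.
move=> z Kz; have := hs z Kz; have := enorm_triangle y x z; lra.
Qed.

End Far.

Section RandomMeasure.
Context {R : realType} {d : nat}.
Local Notation E := (borelRd R d).
Context {disp : measure_display} {Omega : measurableType disp}.
Variable Q : Omega -> {measure set E -> \bar R}.
Hypothesis hQ : forall w, sphere_proba (Q w).
Hypothesis mQ : forall u (c : R), measurable [set w | hmass (Q w) u < c].
Implicit Types (x y : 'rV[R]_d) (K G M : set 'rV[R]_d).

(** The quantifier over x bears on a deterministic condition only: which
    rational normals are admissible for some x in M.  M can thus be any set. *)
Lemma measurable_ahD_lt_on M (c : R) :
  measurable [set w | exists2 x, sphere x /\ M x & ahD (Q w) x < c].
Proof.
rewrite (_ : mkset _ = [set w | exists q : 'rV[rat]_d,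
    (exists x, [/\ sphere x, M x & 0 < dot x (ratv q)]) /\
    hmass (Q w) (ratv q) < c]).
  by apply: measurable_exists => q; exact: (measurable_cond _ (mQ _ _)).
apply/seteqP; split=> w /=.
  by move=> [x [xS xM] /(ahD_ltP (hQ w) _ xS)[q [xq qc]]]; exists q; split=> //; exists x.
move=> [q [[x [xS xM xq]] qc]]; exists x => //.
by apply/(ahD_ltP (hQ w) _ xS); exists q.
Qed.

(** The constraints on x are half-space conditions <x,v_j> <= 0, each imposed
    on the event A j only.  For finitely many of them the event is obtained by
    induction, splitting on A j and shrinking K accordingly; by compactness all
    the constraints hold at one point of K as soon as each finite subfamily is
    satisfied at some point of K. *)
Lemma measurable_compact_hit K (c : R) : compact K -> K `<=` sphere ->
  measurable [set w | exists2 x, K x & c <= ahD (Q w) x].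
Proof.
move=> cK KS.
pose v (j : nat) : 'rV[R]_d := ratv (odflt 0 (unpickle j)).
pose A (j : nat) := [set w | hmass (Q w) (v j) < c].
pose B M n := [set w | exists2 x, M x & forall j, (j < n)%N -> A j w -> dot x (v j) <= 0].
have mB M n : measurable (B M n).
  elim: n M => [|n IH] M.
    rewrite (_ : B M 0%N = [set _ | exists x, M x]); first exact: measurable_cst_set.
    by apply/seteqP; split=> w [x Mx] //; exists x.
  rewrite (_ : B M n.+1 = (B M n `\` A n) `|`
      (B (M `&` [set x | dot x (v n) <= 0]) n `&` A n)).
    apply: measurableU; first by apply: measurableD => //; exact: mQ.
    by apply: measurableI => //; exact: mQ.
  apply/seteqP; split=> w.
    move=> [x Mx xn]; have [nw|nw] := pselect (A n w).
      right; split; last exact: nw.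
      exists x; first by split; [exact: Mx|exact: xn nw].
      by move=> j jn; apply: xn; exact: ltnW.
    left; split; last exact: nw.
    by exists x; [exact: Mx|move=> j jn; apply: xn; exact: ltnW].
  move=> [[[x Mx xn] nw]|[[x [Mx xvn] xn] nw]]; (exists x; first exact: Mx) => j;
    rewrite ltnS leq_eqVlt => /predU1P[->|/xn]; [|exact|move=> _|exact].
    by move/nw.
  exact: xvn.
rewrite (_ : mkset _ = \bigcap_n B K n); first exact: bigcapT_measurable.
apply/seteqP; split=> w.
  move=> [x Kx xc] n _; exists x => // j _ jw; rewrite leNgt; apply/negP => xj.
  suff : ahD (Q w) x < c by rewrite ltNge xc.
  by apply/(ahD_ltP (hQ w) _ (KS x Kx)); exists (odflt 0 (unpickle j)).
move=> KB; apply: contrapT => noK.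
have /compact_near_coveringP cvK := cK.
have /cvK : forall x, K x -> \forall x' \near x & n \near \oo,
    exists2 j, (j < n)%N & A j w /\ 0 < dot x' (v j).
  move=> x Kx; have /(ahD_ltP (hQ w) _ (KS x Kx))[q [xq qc]] : ahD (Q w) x < c.
    by rewrite ltNge; apply/negP => xc; apply: noK; exists x.
  exists ([set y | 0 < dot y (ratv q)], [set n | (pickle q < n)%N]) => /=.
    split; last by exists (pickle q).+1.
    have h := @continuous_dot R d (ratv q) x.
    by have /h : nbhs (dot x (ratv q)) [set r | 0 < r] by exact: lt_nbhsr.
  move=> [y n] /= [yq qn]; exists (pickle q) => //.
  by rewrite /A /v/= pickleK.
move=> [n _ /(_ n (leqnn n)) Kn].
have [x Kx xn] := KB n I; have [j jn [jw xj]] := Kn x Kx.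
by have := xn j jn jw; rewrite leNgt xj.
Qed.

Lemma measurable_open_hit G (c : R) : open G ->
  measurable [set w | exists2 x, sphere x /\ G x & c <= ahD (Q w) x].
Proof.
move=> /open_enormP oG.
pose B (p : 'rV[rat]_d * nat) : set 'rV[R]_d :=
  [set x | enorm (x - ratv p.1) <= p.2.+1%:R^-1].
rewrite (_ : mkset _ = [set w | exists p, B p `<=` G /\
    exists2 x, (sphere `&` B p) x & c <= ahD (Q w) x]).
  apply: measurable_exists => p; apply: measurable_cond.
  apply: measurable_compact_hit; last by move=> x [].
  apply: (subclosed_compact _ (@compact_sphere R d)); last by move=> x [].
  apply: closedI; first exact: closed_sphere.
  apply: (@closed_comp _ _ (fun x => enorm (x - ratv p.1)) [set r | r <= _]).
    by move=> x _; exact: continuous_enormB.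
  exact: closed_le.
apply/seteqP; split=> w /=; last first.
  by move=> [p [pG [x [xS xp] xc]]]; exists x => //; split=> //; exact: pG.
move=> [x [xS Gx] xc]; have [e e0 xe] := oG x Gx.
have [n] := ltr_add_invr (divr_gt0 e0 (ltr0n R 2)); rewrite add0r => ne.
have n0 : 0 < n.+1%:R^-1 :> R by rewrite invr_gt0.
have [q xq] := dense_ratv x n0.
exists (q, n); split.
  move=> y yq; have {}yq : enorm (y - ratv q) <= n.+1%:R^-1 := yq.
  apply: xe; apply: le_lt_trans (enorm_triangle (ratv q) _ _) _.
  rewrite (enorm_sub_sym _ y) [e]splitr.
  exact: ltrD (lt_trans xq ne) (le_lt_trans yq ne).
by exists x => //; split=> //; exact: ltW.
Qed.

(** Rational balls separate the two quantifiers: one that contains a point of M and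
    whose enlargement by t misses the region.  The enlargement is open, so the
    hitting lemma applies, and M may be any set. *)
Lemma measurable_far M (c t : R) :
  measurable [set w | exists2 x, M x & far t (ahD_region (Q w) c) x].
Proof.
(* With balls of radius r, enlarging by t + 2 r leaves a margin r for the
   triangle inequality in each direction. *)
pose r (n : nat) : R := n.+1%:R^-1.
have r0 n : 0 < r n by rewrite invr_gt0.
rewrite (_ : mkset _ = [set w | exists p : 'rV[rat]_d * nat,
    (exists2 x, M x & enorm (x - ratv p.1) < r p.2) /\
    (~` [set w | exists2 y, sphere y /\ enorm (y - ratv p.1) < t + 2 * r p.2 &
                 c <= ahD (Q w) y]) w]).
  apply: measurable_exists => p; apply: measurable_cond; apply: measurableC.
  apply: (measurable_open_hit (G := [set y | enorm (y - ratv p.1) < _])).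
  apply: (@open_comp _ _ (fun x => enorm (x - ratv p.1)) [set s | s < _]).
    by move=> x _; exact: continuous_enormB.
  exact: open_lt.
apply/seteqP; split=> w /=.
  move=> [x Mx [s ts hs]]; have st0 : 0 < (s - t) / 3 by rewrite divr_gt0 ?subr_gt0.
  have [n] := ltr_add_invr st0; rewrite add0r -/(r n) => nst.
  have [q xq] := dense_ratv x (r0 n).
  exists (q, n); split; first by exists x.
  move=> [y [yS /= yq] yc]; have := hs y (conj yS yc).
  have := enorm_triangle (ratv q) x y; rewrite (enorm_sub_sym (ratv q) y).
  lra.
move=> [[q n] /= [[x Mx xq] hy]]; exists x => //.
exists (t + r n); first by have := r0 n; lra.
move=> y [yS yc]; rewrite leNgt; apply/negP => xy; apply: hy.
exists y => //; split=> //.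
have := enorm_triangle x y (ratv q); rewrite (enorm_sub_sym y x); lra.
Qed.

Section Comparison.
Variable P : {measure set E -> \bar R}.
Hypothesis hP : sphere_proba P.

(** A rational number strictly between the two depths separates the
    deterministic condition from the random one.  The set where ahD P is below a
    level is only relatively open in the sphere, whence the interior. *)
Lemma measurable_lt_sup_ahD_dist (t : R) :
  measurable [set w | t < sup [set `|ahD (Q w) x - ahD P x| | x in sphere]].
Proof.
pose U (c : R) := interior [set x | sphere x -> ahD P x < c].
rewrite (_ : mkset _ =
  [set w | exists q : rat, exists2 x, sphere x /\ U (ratr q - t) x &
           ratr q <= ahD (Q w) x] `|`
  [set w | exists q : rat, exists2 x, sphere x /\ ratr q + t < ahD P x &
           ahD (Q w) x < ratr q]).
  apply: measurableU; apply: measurable_exists => q.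
    by apply: measurable_open_hit; exact: open_interior.
  exact: (measurable_ahD_lt_on [set x | ratr q + t < ahD P x]).
have [x0 x0S] := sphere_proba_nonempty hP.
apply/seteqP; split=> w /=.
  move=> /sup_gt[|_ [x xS <-]]; first by exists `|ahD (Q w) x0 - ahD P x0|, x0.
  rewrite ltr_normr opprB => /orP[|] xt.
    have [|q] := @rat_in_itvoo R (ahD P x + t) (ahD (Q w) x); first by lra.
    rewrite in_itv/= => /andP[q1 q2]; left; exists q; exists x; last exact: ltW.
    split=> //; have [|e e0 he] := @ahD_usc _ _ _ hP x (ratr q - t) xS; first by lra.
    by apply/nbhs_enormP; exists e => // y xy yS; exact: he.
  have [|q] := @rat_in_itvoo R (ahD (Q w) x) (ahD P x - t); first by lra.
  rewrite in_itv/= => /andP[q1 q2]; right; exists q; exists x => //.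
  by split=> //; lra.
have ub x : sphere x -> `|ahD (Q w) x - ahD P x| <=
    sup [set `|ahD (Q w) x - ahD P x| | x in sphere].
  move=> xS; apply: ub_le_sup; last by exists x.
  exact: ahD_dist_has_ubound.
move=> [[q [x [xS /interior_subset xq] qx]]|[q [x [xS xq] qx]]];
  apply: lt_le_trans (ub x xS); rewrite ltr_normr; apply/orP.
  by left; have := xq xS; lra.
by right; rewrite opprB; lra.
Qed.

Variable N : nat.
Local Notation level k := (k%:R / N.+1%:R : R).
Hypothesis levelQ : forall w x, sphere x -> exists k : nat, ahD (Q w) x = level k.

Let N0 : 0 < N.+1%:R :> R. Proof. by []. Qed.

Lemma le_level (j k : nat) : (level j <= level k) = (j <= k)%N.
Proof. by rewrite ler_pM2r ?invr_gt0// ler_nat. Qed.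

(** The random region only changes at the levels k / (N + 1).  When the far
    point lies in the random region, alpha can be kept and the level is the
    depth of that point.  When it lies in the region of P, alpha is rounded up to
    the next level, which does not change the random region. *)
Lemma measurable_lt_hausdorff_region (a b t : R) :
  measurable [set w | (t%:E < ereal_sup [set hausdorff_dist
    (ahD_region (Q w) alpha) (ahD_region P alpha) | alpha in `[a, b]])%E].
Proof.
pose G (k : nat) := [set x | exists alpha, [/\ a <= alpha <= b, alpha <= level k &
  far t (ahD_region P alpha) x]].
pose M (k : nat) := [set x | exists alpha, [/\ a <= alpha <= b,
  ahD_region P alpha x, alpha <= level k &
  forall j : nat, alpha <= level j -> (k <= j)%N]].
rewrite (_ : mkset _ =
  [set w | exists k : nat, exists2 x, sphere x /\ G k x & level k <= ahD (Q w) x] `|`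
  [set w | exists k : nat, exists2 x, M k x & far t (ahD_region (Q w) (level k)) x]).
  apply: measurableU; apply: measurable_exists => k; last exact: measurable_far.
  apply: measurable_open_hit; rewrite (_ : G k = \bigcup_(alpha in
      [set alpha | a <= alpha <= b /\ alpha <= level k]) far t (ahD_region P alpha)).
    by apply: bigcup_open => alpha _; exact: open_far.
  apply/seteqP; split=> x; first by move=> [alpha [h1 h2 h3]]; exists alpha.
  by move=> [alpha [h1 h2] h3]; exists alpha.
apply/seteqP; split=> w /=.
  move=> /ereal_sup_gt[_ [alpha aab <-] /lt_hausdorff_distP[]]; rewrite /= in_itv/= in aab.
    move=> [x [xS xa] xfar]; left; have [k xk] := levelQ w xS.
    by exists k; exists x; rewrite ?xk//; split=> //; exists alpha; split=> //; rewrite -xk.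
  move=> [x xa [s ts hs]]; right.
  have ex : exists k : nat, alpha <= level k.
    exists (Num.bound `|alpha * N.+1%:R|); rewrite ler_pdivlMr//.
    exact: le_trans (ler_norm _) (ltW (archi_boundP (normr_ge0 _))).
  have [k ak kmin] := ex_minnP ex; exists k; exists x; first by exists alpha.
  by exists s => // y [yS ky]; apply: hs; split=> //; exact: le_trans ak ky.
move=> [[k [x [xS [alpha [aab ak xfar]]] kx]]|[k [x [alpha [aab xa ak kmin]] [s ts hs]]]].
  have : (t%:E < hausdorff_dist (ahD_region (Q w) alpha) (ahD_region P alpha))%E.
    apply/lt_hausdorff_distP; left; exists x => //; split=> //; exact: le_trans ak kx.
  move=> /lt_le_trans; apply; by apply: ereal_sup_ubound; exists alpha.
have : (t%:E < hausdorff_dist (ahD_region (Q w) alpha) (ahD_region P alpha))%E.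
  apply/lt_hausdorff_distP; right; exists x => //; exists s => // y [yS ya].
  apply: hs; split=> //; have [j yj] := levelQ w yS.
  by rewrite yj le_level; apply: kmin; rewrite -yj.
move=> /lt_le_trans; apply; by apply: ereal_sup_ubound; exists alpha.
Qed.

(** The maximal depth is the last level k that some point of the sphere
    reaches.  As the medians of Q w are nonempty, the distance from m to them is
    at most the largest distance of one of them to m, so only the latter
    matters. *)
Lemma measurable_lt_hausdorff_medians (m : 'rV[R]_d) (t : R) :
  (forall w, exists2 z, sphere z & ahD (Q w) z = ahD_max (Q w)) ->
  measurable [set w | (t%:E < hausdorff_dist (medians (Q w)) [set m])%E].
Proof.
move=> maxQ.
rewrite (_ : mkset _ = [set w | exists k : nat,
  (exists2 x, sphere x /\ t < enorm (x - m) & level k <= ahD (Q w) x) /\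
  ~ (exists2 x, sphere x /\ setT x & level k.+1 <= ahD (Q w) x)]).
  apply: measurable_exists => k; apply: measurableI; last first.
    by apply: measurableC; apply: measurable_open_hit; exact: openT.
  apply: (measurable_open_hit (G := [set x | t < enorm (x - m)])).
  apply: (@open_comp _ _ (fun x => enorm (x - m)) [set s | t < s]).
    by move=> x _; exact: continuous_enormB.
  exact: open_gt.
apply/seteqP; split=> w /=; have [z zS zmax] := maxQ w.
  move=> /lt_hausdorff_distP h.
  have [x [xS xmax] xm] : exists2 x, medians (Q w) x & t < enorm (x - m).
    case: h => [[x xQ [s ts hs]]|[x -> [s ts hs]]].
      by exists x => //; apply: lt_le_trans ts _; exact: hs.
    exists z => //; apply: lt_le_trans ts _.
    by rewrite enorm_sub_sym; exact: hs.
  have [k xk] := levelQ w xS; exists k; split; first by exists x; rewrite ?xk.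
  move=> [y [yS _]]; rewrite leNgt => /negP; apply.
  apply: le_lt_trans (ahD_le_max (hQ w) yS) _.
  by rewrite -xmax xk ltNge le_level ltnn.
move=> [k [[x [xS xm] kx] nk]]; apply/lt_hausdorff_distP; left.
exists x; last by exists (enorm (x - m)) => // y ->.
split=> //; apply/eqP; rewrite eq_le ahD_le_max//= -zmax.
apply: le_trans kx; have [j zj] := levelQ w zS; rewrite zj le_level.
rewrite leqNgt; apply/negP => kj; apply: nk.
by exists z => //; rewrite zj le_level.
Qed.

End Comparison.
End RandomMeasure.

(** * Almost sure uniform convergence *)

Lemma filter_finite_forall (T : Type) (I : choiceType) (G : set_system T)
    (D : set I) (A : I -> T -> Prop) : Filter G -> finite_set D ->
  (forall i, D i -> G (A i)) -> G [set w | forall i, D i -> A i w].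
Proof.
move=> FG /finite_seqP[s ->]; elim: s => [|i s IH] h.
  by apply: filterE => w i; rewrite /= in_nil.
have Gs : G [set w | forall j, [set` s] j -> A j w].
  by apply: IH => j js; apply: h; rewrite /= inE js orbT.
have Gi : G (A i) by apply: h; rewrite /= inE eqxx.
apply: filterS2 Gi Gs => w Aw Asw j; rewrite /= inE => /predU1P[->//|].
exact: Asw.
Qed.

Section GlivenkoCantelli.
Context {R : realType} {d : nat}.
Local Notation E := (borelRd R d).
Context {disp : measure_display} {Omega : measurableType disp}.
Variables (Pr : probability Omega R) (P : probability E R).
Hypothesis hP : sphere_proba P.
Variable X : nat -> {RV Pr >-> E}.
Hypothesis X_sphere : forall i w, sphere (X i w).
Hypothesis X_indep : mutually_independent X.
Hypothesis X_distr : forall i (B : set E), measurable B ->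
  distribution Pr (X i) B = P B.

Let Pn (n : nat) (w : Omega) := empirical n.+1 (fun i => X i w).

Let hPn n w : sphere_proba (Pn n w).
Proof. exact: empirical_sphere_proba. Qed.

Lemma empirical_event_count n w (B : set E) :
  fine (Pn n w B) = event_count (fun i => X i @^-1` B) n.+1 w / n.+1%:R.
Proof. by rewrite /Pn empiricalE. Qed.

Lemma measurable_preimage_sample i (B : set E) : measurable B ->
  measurable (X i @^-1` B).
Proof. by move=> mB; rewrite -[_ @^-1` _]setTI; exact: measurable_funP. Qed.

Lemma measurable_hmass_empirical n u (c : R) :
  measurable [set w | hmass (Pn n w) u < c].
Proof.
have mH := @measurable_halfspace0 R d u.
rewrite (_ : mkset _ = setT `&` (fun w => event_count
   (fun i => X i @^-1` halfspace0 u) n.+1 w / n.+1%:R) @^-1` `]-oo, c[).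
  have mf : measurable_fun setT (event_count (R := R)
      (fun i => X i @^-1` halfspace0 u) n.+1).
    by apply: measurable_event_count => i; exact: measurable_preimage_sample.
  exact: (measurable_funM mf (measurable_cst (n.+1%:R^-1 : R))).
apply/seteqP; split=> w /=; rewrite in_itv/= /hmass empirical_event_count//.
by case.
Qed.

Lemma empirical_lln (B : set E) : measurable B ->
  {ae Pr, forall w, fine (Pn n w B) @[n --> \oo] --> fine (P B)}.
Proof.
move=> mB; pose A i := X i @^-1` B.
have PB : P B \is a fin_num by exact: sphere_proba_fin.
have mA i : measurable (A i) by exact: measurable_preimage_sample.
have PA i : Pr (A i) = (fine (P B))%:E by rewrite fineK// -(X_distr i mB).
have PAA i j : i != j -> Pr (A i `&` A j) = (fine (P B) * fine (P B))%:E.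
  move=> ij; have ij_uniq : uniq [:: i; j] by rewrite cons_uniq mem_seq1 ij.
  have := X_indep ij_uniq (fun=> mB); rewrite big_cons big_seq1 -!/(A _) !PA -EFinM => <-; congr (Pr _).
  apply/seteqP; split=> w.
    by move=> [wi wj] k; rewrite /= mem_seq2 => /orP[] /eqP ->.
  by move=> h; split; apply: h; rewrite /= mem_seq2 eqxx ?orbT.
apply: filterS (event_lln mA PA PAA) => w.
by under eq_fun do rewrite -empirical_event_count.
Qed.

(** If L and U bracket a halfspace, its P-mass and its empirical mass both lie
    between the corresponding masses of L and U; these differ by at most r for P and
    the empirical masses are within r of those of P. *)
Lemma as_uniform_halfspaces :
  {ae Pr, forall w, forall e : R, 0 < e ->
    \forall n \near \oo, forall u, `|hmass (Pn n w) u - hmass P u| <= e}.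
Proof.
have h m : {ae Pr, forall w, \forall n \near \oo, forall u,
    `|hmass (Pn n w) u - hmass P u| <= 2 * m.+1%:R^-1}.
  have m0 : 0 < m.+1%:R^-1 :> R by rewrite invr_gt0.
  have [F fF FP] := finite_bracketing (sphere_proba_finite hP) m0.
  have : {ae Pr, forall w, forall LU, F LU ->
      measurable LU.1 -> measurable LU.2 ->
      fine (Pn n w LU.1) @[n --> \oo] --> fine (P LU.1) /\
      fine (Pn n w LU.2) @[n --> \oo] --> fine (P LU.2)}.
    apply: filter_finite_forall => // LU _.
    have [mL|nmL] := pselect (measurable LU.1); last by apply: aeW => w /nmL.
    have [mU|nmU] := pselect (measurable LU.2); last by apply: aeW => w _ /nmU.
    by apply: filterS2 (empirical_lln mL) (empirical_lln mU) => w.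
  apply: filterS => w wF; move: (m.+1%:R^-1) m0 FP => r r0 FP.
  have : \forall n \near \oo, forall LU, F LU ->
      measurable LU.1 -> measurable LU.2 ->
      `|fine (P LU.1) - fine (Pn n w LU.1)| <= r /\
      `|fine (P LU.2) - fine (Pn n w LU.2)| <= r.
    apply: filter_finite_forall => // LU FLU.
    have [mL|nmL] := pselect (measurable LU.1); last by exists 0%N => // n _ /nmL.
    have [mU|nmU] := pselect (measurable LU.2); last by exists 0%N => // n _ _ /nmU.
    have [/cvgrPdist_le/(_ r r0) hL /cvgrPdist_le/(_ r r0) hU] := wF _ FLU mL mU.
    by apply: filterS2 hL hU => n.
  apply: filterS => n nF u; have [LU FLU [mL mU LA AU PLU]] := FP u.
  have [hL hU] := nF _ FLU mL mU.
  have mA : measurable (sphere `&` halfspace0 u : set E).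
    apply: measurableI; first exact: measurable_sphere.
    exact: measurable_halfspace0.
  have between (Q : {measure set E -> \bar R}) : sphere_proba Q ->
      fine (Q LU.1) <= hmass Q u <= fine (Q LU.2).
    move=> hQ; rewrite -!lee_fin hmassE// !fineK ?sphere_proba_fin//.
    by rewrite !le_measure ?inE.
  have gap : fine (P LU.2) <= fine (P LU.1) + r.
    have mD := measurableD mU mL.
    rewrite -lee_fin EFinD !fineK ?sphere_proba_fin//.
    have -> : P LU.2 = (P (LU.2 `\` LU.1) + P LU.1)%E.
      have := measureDI P mU mL.
      by rewrite (_ : LU.2 `&` LU.1 = LU.1)//; apply: setIidr; exact: subset_trans AU.
    by apply: le_trans (leeD (ltW PLU) (lexx (P LU.1))) _; rewrite addeC.
  have := between _ (hPn n w); have := between _ hP.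
  by move: hL hU; rewrite !ler_norml; lra.
apply: filterS (ae_foralln h) => w hw e e0.
have [m] := ltr_add_invr (divr_gt0 e0 (ltr0n R 2)); rewrite add0r => me.
apply: filterS (hw m) => n hn u; apply: le_trans (hn u) _.
by rewrite -ler_pdivlMl// mulrC ltW.
Qed.

Lemma as_uniform_ahD :
  {ae Pr, forall w, forall e : R, 0 < e ->
    \forall n \near \oo, forall x, sphere x -> `|ahD (Pn n w) x - ahD P x| <= e}.
Proof.
apply: filterS as_uniform_halfspaces => w h e e0; apply: filterS (h e e0) => n hn.
exact: ahD_uniform.
Qed.

End GlivenkoCantelli.

Lemma ae_has_probability_one (R : realType) (disp : measure_display)
    (Omega : measurableType disp) (Pr : probability Omega R) (A : set Omega) :
  measurable A -> {ae Pr, forall w, A w} -> has_probability_one Pr A.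
Proof.
move=> mA aeA; split=> //.
have PC0 : Pr (~` A) = 0%E by apply/negligibleP => //; exact: measurableC.
by rewrite -(setCK A) probability_setC ?PC0 ?sube0//; exact: measurableC.
Qed.

Theorem theorem13 (R : realType) (d : nat) (hd : (2 <= d)%N)
    (disp : measure_display) (Omega : measurableType disp)
    (Pr : probability Omega R)
    (P : probability (borelRd R d) R) (hP : P sphere = 1%E)
    (X : nat -> {RV Pr >-> borelRd R d})
    (X_sphere : forall i w, sphere (X i w))
    (X_indep : mutually_independent X)
    (X_distr : forall i (B : set (borelRd R d)), measurable B ->
       distribution Pr (X i) B = P B) :
  let Pn (n : nat) (w : Omega) := empirical n.+1 (fun i => X i w) in
  [/\ has_probability_one Pr
        [set w | sup [set `|ahD (Pn n w) x - ahD P x| | x in sphere]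
                   @[n --> \oo] --> (0 : R)],
      strictly_monotone P ->
        forall a b : R, a <= b ->
          `[a, b] `<=` `]ahD_min P, ahD_max P[ ->
          has_probability_one Pr
            [set w | ereal_sup [set hausdorff_dist (ahD_region (Pn n w) alpha)
                                      (ahD_region P alpha) | alpha in `[a, b]]
                       @[n --> \oo] --> 0%E]
    & (forall H : set 'rV[R]_d, halfspaces0 H -> P (boundary H) = 0%E) ->
      (exists m, medians P = [set m]) ->
        has_probability_one Pr
          [set w | hausdorff_dist (medians (Pn n w)) (medians P)
                     @[n --> \oo] --> 0%E]].
Proof.
move=> Pn.
have hP' : sphere_proba P by split=> //; exact: probability_setT.
have hPn n w : sphere_proba (Pn n w) by exact: empirical_sphere_proba.
have mPn n u c : measurable [set w | hmass (Pn n w) u < c].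
  exact: measurable_hmass_empirical.
have levelPn n w x : sphere x -> exists k : nat, ahD (Pn n w) x = k%:R / n.+1%:R.
  exact: ahD_empirical_level.
have maxPn n w : exists2 z, sphere z & ahD (Pn n w) z = ahD_max (Pn n w).
  exact: empirical_ahD_max.
have unif := as_uniform_ahD hP' X_sphere X_indep X_distr.
have [x0 x0S] := sphere_proba_nonempty hP'.
split.
- pose f n w : \bar R := (sup [set `|ahD (Pn n w) x - ahD P x| | x in sphere])%:E.
  have f0 n w : (0 <= f n w)%E.
    rewrite lee_fin; apply: le_trans (normr_ge0 (ahD (Pn n w) x0 - ahD P x0)) _.
    by apply: ub_le_sup; [exact: ahD_dist_has_ubound|exists x0].
  rewrite (_ : mkset _ = [set w | f n w @[n --> \oo] --> 0%E]); last first.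
    apply/seteqP; split=> w /= h; last by have /fine_cvgP[] := h.
    by apply/fine_cvgP; split=> //; exact: nearW.
  apply: ae_has_probability_one.
    apply: measurable_cvge0 => // n t _.
    exact: (measurable_lt_sup_ahD_dist (hPn n) (mPn n) hP').
  apply: filterS unif => w unif; apply: cvge0P => // e e0.
  apply: filterS (unif e e0) => n hn; rewrite lee_fin; apply: ge_sup.
    by exists `|ahD (Pn n w) x0 - ahD P x0|, x0.
  by move=> _ [x xS <-]; exact: hn.
- move=> mono a b ab abP.
  have aI : [set` `[a, b]] a by rewrite /= in_itv/= lexx ab.
  have bmax : a < ahD_max P by have := abP a aI; rewrite /= in_itv/= => /andP[].
  have f0 n w : (0 <= ereal_sup [set hausdorff_dist (ahD_region (Pn n w) alpha)
                            (ahD_region P alpha) | alpha in `[a, b]])%E.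
    apply: le_ereal_sup_tmp; exists (hausdorff_dist (ahD_region (Pn n w) a)
                            (ahD_region P a)); first by exists a.
    by apply: hausdorff_dist_ge0; exact: ahD_region_nonempty.
  apply: ae_has_probability_one.
    apply: measurable_cvge0 => // n t _.
    exact: (measurable_lt_hausdorff_region (hPn n) (mPn n) P (levelPn n)).
  apply: filterS unif => w unif; apply: cvge0P => // t t0.
  have [e e0 he] := region_stability hP' mono abP t0.
  apply: filterS (unif e e0) => n hn; apply: ge_ereal_sup => _ [alpha aab <-].
  by apply: he => //; move: aab; rewrite /= in_itv.
move=> _ [m Pm].
have f0 n w : (0 <= hausdorff_dist (medians (Pn n w)) (medians P))%E.
  by apply: hausdorff_dist_ge0; rewrite Pm; exists m.
apply: ae_has_probability_one.
  apply: measurable_cvge0 => // n t _; rewrite Pm.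
  exact: (measurable_lt_hausdorff_medians (hPn n) (mPn n) (levelPn n)).
apply: filterS unif => w unif; apply: cvge0P => // t t0.
have [e e0 he] := median_stability hP' Pm t0.
apply: filterS (unif e e0) => n hn; apply: he => //.
  by have [z zS zmax] := maxPn n w; exists z.
by move=> x xS; exact: ahD_le_max.
Qed.
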